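(* Let $M^n$ be an $n$-dimensional totally real submanifold with flat normal connection in a complex space form $\tilde M^{n+p}(c)$ ($c\neq 0$) of complex dimension $n+p$ and constant holomorphic sectional curvature $c$, and let $x\in M^n$. Let $V_x=J(T_xM^n)\subset T_x^\perp M^n$ and let $V_x^\perp$ be the orthogonal complement of $V_x$ in $T_x^\perp M^n$. Then a nonzero normal vector $\xi\in T_x^\perp M^n$ is umbilical if and only if $\xi\in V_x^\perp$.
   Context: A complex space form $\tilde M^{n+p}(c)$ is a Kähler manifold of complex dimension $n+p$, with complex structure $J$, of constant holomorphic sectional curvature $c$. An $n$-dimensional (real dimension $n$) immersed submanifold $M^n$, with the induced metric and second fundamental form $h$, is totally real if $J(T_xM)\subset T_x^\perp M$ for every $x\in M$. For $\xi\in T_x^\perp M$, the shape operator $A_\xi$ is defined by $\langle A_\xi X,Y\rangle=\langle h(X,Y),\xi\rangle$. The vector $\xi$ is called umbilical if $A_\xi$ is a scalar multiple of the identity of $T_xM$, equivalently $\langle h(X,Y),\xi\rangle=\langle\xi,\zeta\rangle\langle X,Y\rangle$ for all $X,Y\in T_xM$, where $\zeta=\frac1n\operatorname{trace}h$ is the mean curvature vector. The normal connection is flat if the normal curvature tensor $R^\perp$ vanishes identically.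
   Formalization: The dimension n of M is assumed to be at least 2; for n = 1 the claim is false, since every normal vector of a curve is umbilical, including the nonzero vectors of V_x = J(T_xM), and n = 0 is degenerate. *)

(* Defs.v *)
From HB Require Import structures.
From mathcomp Require Import all_boot all_order all_algebra.
From mathcomp Require Import all_classical all_reals all_analysis.

Set Implicit Arguments.
Unset Strict Implicit.
Unset Printing Implicit Defensive.

Import Order.TTheory GRing.Theory Num.Theory.
Import numFieldNormedType.Exports.

Local Open Scope classical_set_scope.
Local Open Scope ring_scope.

(* Vectors are rows and linear maps act on the right: the differential of f
   at u sends X to X *m 'J f u, and a bilinear form G sends (v, w) to
   v *m G *m w^T. *)

(** * Smooth manifolds *)

(* On an open set A this is the usual notion of class C^k. *)
Fixpoint class_C (R : realType) (m : nat) (W : normedModType R) (k : nat)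
    (A : set 'rV[R]_m) (f : 'rV[R]_m -> W) : Prop :=
  match k with
  | 0 => forall u, A u -> {for u, continuous f}
  | k'.+1 => (forall u, A u -> differentiable f u) /\
             (forall v, class_C k' A (fun u => 'D_v f u))
  end.

Definition smooth_on (R : realType) (m : nat) (W : normedModType R)
    (A : set 'rV[R]_m) (f : 'rV[R]_m -> W) : Prop :=
  forall k, class_C k A f.

(* [chart i] and [param i] are mutually inverse homeomorphisms between the open
   set [chart_dom i] and its open image; their values elsewhere are junk. *)
Record smoothManifold (R : realType) (m : nat) := SmoothManifold {
  carrier :> topologicalType;
  carrier_hausdorff : hausdorff_space carrier;
  carrier_second_countable : @second_countable carrier;
  chart_index : Type;
  chart_dom : chart_index -> set carrier;
  chart : chart_index -> carrier -> 'rV[R]_m;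
  param : chart_index -> 'rV[R]_m -> carrier;
  chart_cover : forall x, exists i, chart_dom i x;
  chart_dom_open : forall i, open (chart_dom i);
  chart_image_open : forall i, open (chart i @` chart_dom i);
  chartK : forall i x, chart_dom i x -> param i (chart i x) = x;
  chart_continuous : forall i x, chart_dom i x -> {for x, continuous (chart i)};
  param_continuous : forall i u, (chart i @` chart_dom i) u ->
    {for u, continuous (param i)};
  transition_smooth : forall i j,
    smooth_on (chart i @` (chart_dom i `&` chart_dom j)) (chart j \o param i)
}.

(** * Riemannian geometry in a coordinate system *)

Section Coordinates.
Variables (R : realType) (m : nat).
Implicit Types (G : 'rV[R]_m -> 'M[R]_m) (y v w X Y Z : 'rV[R]_m).

Definition inner (d : nat) (B : 'M[R]_d) (v w : 'rV[R]_d) : R :=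
  (v *m B *m w^T) 0 0.

(* The vector with components \sum_(i, j) v^i w^j Gamma_ij^k. *)
Definition christoffel G y v w : 'rV[R]_m :=
  (\row_l (2^-1 * (inner ('D_v G y) w (delta_mx 0 l)
                 + inner ('D_w G y) v (delta_mx 0 l)
                 - inner ('D_(delta_mx 0 l) G y) v w))) *m invmx (G y).

(* Levi-Civita derivative in the direction v of a vector field xi along f. *)
Definition covderiv (d : nat) G (f : 'rV[R]_d -> 'rV[R]_m) (v : 'rV[R]_d)
    (xi : 'rV[R]_d -> 'rV[R]_m) (u : 'rV[R]_d) : 'rV[R]_m :=
  'D_v xi u + christoffel G (f u) ('D_v f u) (xi u).

(* R(X,Y)Z, computed with the extensions of X, Y, Z having constant
   coefficients, for which [X,Y] = 0. *)
Definition curvature G y X Y Z : 'rV[R]_m :=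
  covderiv G id X (covderiv G id Y (cst Z)) y
  - covderiv G id Y (covderiv G id X (cst Z)) y.

Definition sectional_curvature G y X Y : R :=
  inner (G y) (curvature G y X Y Y) X /
  (inner (G y) X X * inner (G y) Y Y - inner (G y) X Y ^+ 2).

End Coordinates.

(** * Kaehler manifolds *)

(* Multiplication by the imaginary unit on C^m = R^m x R^m:
   (a, b) |-> (- b, a). *)
Definition cplxJ (R : realType) (m : nat) : 'M[R]_(m + m) :=
  block_mx 0 1%:M (- 1%:M) 0.

(* The charts are holomorphic coordinates, so that the complex structure is
   [cplxJ] in each of them; [metric i] is the Gram matrix of the metric in the
   chart i; the last field says that the fundamental form <JX, Y> is closed. *)
Record kahlerManifold (R : realType) (m : nat) := KahlerManifold {
  kahler_base :> smoothManifold R (m + m);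
  transition_holomorphic : forall (i j : chart_index kahler_base) y,
    (chart i @` (chart_dom i `&` chart_dom j)) y ->
    cplxJ R m *m 'J (chart j \o param i) y
    = 'J (chart j \o param i) y *m cplxJ R m;
  metric : chart_index kahler_base -> 'rV[R]_(m + m) -> 'M[R]_(m + m);
  metric_smooth : forall i, smooth_on (chart i @` chart_dom i) (metric i);
  metric_sym : forall i y, (chart i @` chart_dom i) y ->
    (metric i y)^T = metric i y;
  metric_pos : forall i y, (chart i @` chart_dom i) y ->
    forall v, v != 0 -> 0 < inner (metric i y) v v;
  metric_transition : forall i j y,
    (chart i @` (chart_dom i `&` chart_dom j)) y ->
    metric i y
    = 'J (chart j \o param i) y
      *m metric j ((chart j \o param i) y)
      *m ('J (chart j \o param i) y)^T;
  metric_hermitian : forall i y, (chart i @` chart_dom i) y ->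
    forall v w, inner (metric i y) (v *m cplxJ R m) (w *m cplxJ R m)
                = inner (metric i y) v w;
  kahler_closed : forall i y, (chart i @` chart_dom i) y ->
    forall X Y Z : 'rV[R]_(m + m),
      'D_X (fun z => inner (metric i z) (Y *m cplxJ R m) Z) y
      + 'D_Y (fun z => inner (metric i z) (Z *m cplxJ R m) X) y
      + 'D_Z (fun z => inner (metric i z) (X *m cplxJ R m) Y) y = 0
}.

Definition const_holomorphic_curvature (R : realType) (m : nat)
    (N : kahlerManifold R m) (c : R) : Prop :=
  forall (i : chart_index N) y, (chart i @` chart_dom i) y ->
  forall X : 'rV[R]_(m + m), X != 0 ->
    sectional_curvature (metric i) y X (X *m cplxJ R m) = c.

(** * Submanifold geometry in coordinates *)

(* f is the coordinate expression of an immersion, G that of the ambient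
   metric, and u the coordinates of a point of the submanifold. *)
Section Submanifold.
Variables (R : realType) (n m : nat).
Variables (G : 'rV[R]_m -> 'M[R]_m) (f : 'rV[R]_n -> 'rV[R]_m).
Implicit Types (u X Y : 'rV[R]_n).

Definition tangent_space_at u : set 'rV[R]_m := [set X *m 'J f u | X in setT].

Definition normal_space_at u : set 'rV[R]_m :=
  [set xi | forall t, tangent_space_at u t -> inner (G (f u)) xi t = 0].

Definition induced_metric u : 'M[R]_n :=
  'J f u *m G (f u) *m ('J f u)^T.

Definition tangent_part u (w : 'rV[R]_m) : 'rV[R]_m :=
  w *m G (f u) *m ('J f u)^T *m invmx (induced_metric u) *m 'J f u.

Definition normal_part u (w : 'rV[R]_m) : 'rV[R]_m := w - tangent_part u w.

(* h(X,Y), with Y extended with constant coefficients. *)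
Definition second_form u X Y : 'rV[R]_m :=
  normal_part u (covderiv G f X (fun u' => 'D_Y f u') u).

(* The matrix A (acting on rows by X |-> X *m A) determined by
   <A_xi X, Y> = <h(X,Y), xi>, i.e. by A *m g = (<h(e_a,e_b), xi>)_ab, where g
   is the induced metric. *)
Definition shape_operator u (xi : 'rV[R]_m) : 'M[R]_n :=
  (\matrix_(a, b)
     inner (G (f u)) (second_form u (delta_mx 0 a) (delta_mx 0 b)) xi)
  *m invmx (induced_metric u).

Definition umbilical u (xi : 'rV[R]_m) : Prop :=
  exists l : R, shape_operator u xi = l%:M.

Definition normal_covderiv X (xi : 'rV[R]_n -> 'rV[R]_m) u : 'rV[R]_m :=
  normal_part u (covderiv G f X xi u).

(* For X, Y with constant coefficients, so that [X,Y] = 0. *)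
Definition normal_curvature X Y (xi : 'rV[R]_n -> 'rV[R]_m) u : 'rV[R]_m :=
  normal_covderiv X (normal_covderiv Y xi) u
  - normal_covderiv Y (normal_covderiv X xi) u.

End Submanifold.

Section ComplexNormal.
Variables (R : realType) (n m : nat).
Variables (G : 'rV[R]_(m + m) -> 'M[R]_(m + m)).
Variables (f : 'rV[R]_n -> 'rV[R]_(m + m)).

Definition J_tangent_space (u : 'rV[R]_n) : set 'rV[R]_(m + m) :=
  [set t *m cplxJ R m | t in tangent_space_at f u].

Definition J_tangent_perp (u : 'rV[R]_n) : set 'rV[R]_(m + m) :=
  normal_space_at G f u `&`
  [set xi | forall w, J_tangent_space u w -> inner (G (f u)) xi w = 0].

End ComplexNormal.

(** * Immersed submanifolds of a Kaehler manifold *)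

Section Immersion.
Variables (R : realType) (n m : nat).
Variables (M : smoothManifold R n) (N : kahlerManifold R m) (F : M -> N).

Definition local_rep (i : chart_index M) (k : chart_index N) :
    'rV[R]_n -> 'rV[R]_(m + m) :=
  chart k \o F \o param i.

Definition local_dom (i : chart_index M) (k : chart_index N) :
    set 'rV[R]_n :=
  chart i @` (chart_dom i `&` F @^-1` chart_dom k).

Definition immersion : Prop :=
  continuous F /\
  forall i k, smooth_on (local_dom i k) (local_rep i k) /\
    forall u, local_dom i k u -> row_free ('J (local_rep i k) u).

Definition totally_real : Prop :=
  forall i k u, local_dom i k u ->
    J_tangent_space (local_rep i k) u
      `<=` normal_space_at (metric k) (local_rep i k) u.

Definition flat_normal_connection : Prop :=
  forall i k (U : set 'rV[R]_n) (xi : 'rV[R]_n -> 'rV[R]_(m + m)),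
    open U -> U `<=` local_dom i k -> smooth_on U xi ->
    (forall u, U u -> normal_space_at (metric k) (local_rep i k) u (xi u)) ->
  forall u, U u -> forall X Y : 'rV[R]_n,
    normal_curvature (metric k) (local_rep i k) X Y xi u = 0.

End Immersion.

(* Main.v *)
(* The Ricci equation for a flat normal connection reads
     <R(X,Y) xi, eta> = <A_eta A_xi X, Y> - <A_xi A_eta X, Y>   (xi, eta normal).
   Constant holomorphic curvature and the symmetries of R determine R, and on a
   totally real submanifold the left side becomes
     (c/4) (<JY,xi><JX,eta> - <JX,xi><JY,eta>).
   If xi is umbilical, the right side vanishes; taking eta = JZ gives
   <JY,xi><X,Z> = <JX,xi><Y,Z> for all X, Y, Z, hence <JX,xi> = 0 because n >= 2.
   If xi is orthogonal to J(TM), then A_xi commutes with all the A_JZ, hence with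
   their commutators, which by the same equation are (c/4) Z /\ W and span so(n);
   a symmetric endomorphism commuting with so(n), n >= 2, is scalar. *)
Require Import Defs.
From HB Require Import structures.
From mathcomp Require Import all_boot all_order all_algebra.
From mathcomp Require Import all_classical all_reals all_analysis.
From mathcomp Require Import ring lra.
Set Implicit Arguments.
Unset Strict Implicit.
Unset Printing Implicit Defensive.

Import Order.TTheory GRing.Theory Num.Theory.
Import numFieldNormedType.Exports.
Local Open Scope classical_set_scope.
Local Open Scope ring_scope.

(** * Functions of class C^k *)

Section ClassC.
Context {R : realType} {m : nat}.
Implicit Types (A : set 'rV[R]_m) (W : normedModType R) (k : nat).

(** The bound n >= 2 is essential: on a curve every shape operator is a 1 x 1 matrix, hence scalar,
    so the vectors of J(TM) would be umbilical too. That constant holomorphic curvature determines R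
    is a uniqueness statement. The model tensor, normalized to holomorphic curvature 4 (whence c/4),
    is subtracted from R; the difference keeps all symmetries of a Kähler curvature tensor and
    vanishes on holomorphic planes, so polarization and the Bianchi identity kill it. The Kähler
    hypothesis enters as ∇J = 0, which makes R commute with J. The geometry is given by directional
    derivatives in charts. A connection is therefore recast as a matrix ω(v) acting on rows from the
    right, with ∇_v ξ = D_v ξ + ξ ω(v); compatibility with the metric, curvature and the Ricci
    equation then become matrix identities that rest on the symmetry of second derivatives. Flatness
    speaks of normal fields and the theorem of a single vector: the vector is extended by projecting
    the constant field onto the normal spaces, and this extension has to be shown smooth. *)

Lemma near_eq_differentiable W (f g : 'rV[R]_m -> W) u :
  {near u, f =1 g} -> differentiable f u -> differentiable g u.
Proof.
move=> fg df; have fgu : f u = g u by exact: (nbhs_singleton fg).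
(* The first order expansion of [f] is also one of [g]; uniqueness of the differential then
   identifies the two differentials. *)
have expand : g \o shift u = cst (g u) + 'd f u +o_ 0 id.
  apply/eqaddoP => e e0; have /eqaddoP/(_ _ e0) := diff_locally df.
  move: fg; rewrite (near_shift 0) /= => fg.
  apply: filterS2 fg => h fgh; rewrite subr0 in fgh.
  by rewrite !fctE /= -fgh -fgu.
have dgf : 'd g u = 'd f u :> (_ -> _).
  apply: diff_unique; [exact: diff_continuous|exact: expand].
apply/diff_locallyP; rewrite dgf; split; [exact: diff_continuous|exact: expand].
Qed.

(** Openness of [A] matters already for k = 0, since continuity and derivatives at a point of [A]
    are taken in the whole space. This lets a derivative be replaced by a formula valid on [A]
    only. *)
Lemma class_C_ext A W k (f g : 'rV[R]_m -> W) : open A ->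
  (forall u, A u -> f u = g u) -> class_C k A f -> class_C k A g.
Proof.
move=> oA; elim: k f g => [|k IH] f g fg /=.
  move=> Cf u Au.
  have fgn : \forall x \near u, f x = g x.
    by apply: filterS fg _; apply: open_nbhs_nbhs.
  rewrite /prop_for /continuous_at -(fg _ Au).
  have Cfu : f x @[x --> u] --> f u := Cf u Au.
  exact: (cvg_trans (near_eq_cvg fgn) Cfu).
move=> [df Cf]; split=> [u Au|v].
  apply: near_eq_differentiable (df u Au).
  by apply: filterS fg _; apply: open_nbhs_nbhs.
apply: IH (Cf v) => u Au; apply: near_eq_derive.
by apply: filterS fg _; apply: open_nbhs_nbhs.
Qed.

Lemma class_CW A W k (f : 'rV[R]_m -> W) : class_C k.+1 A f -> class_C k A f.
Proof.
elim: k f => [|k IH] f [df Cf] /=.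
  by move=> u Au; apply: differentiable_continuous; exact: df.
by split=> // v; apply: IH; exact: Cf.
Qed.

Lemma class_C_cst A W k (w : W) : class_C k A (fun=> w).
Proof.
elim: k w => [|k IH] w /=; first by move=> u _; exact: cst_continuous.
split=> [u _|v]; first exact: differentiable_cst.
rewrite (_ : 'D_v _ = fun=> 0); first exact: IH.
by apply/funext => u; exact: derive_cst.
Qed.

Lemma class_CD A W k (f g : 'rV[R]_m -> W) : open A ->
  class_C k A f -> class_C k A g -> class_C k A (fun u => f u + g u).
Proof.
move=> oA; elim: k f g => [|k IH] f g /=.
  by move=> Cf Cg u Au; apply: continuousD; [exact: Cf|exact: Cg].
move=> [df Cf] [dg Cg]; split=> [u Au|v].
  by apply: differentiableD; [exact: df|exact: dg].
apply: class_C_ext (IH _ _ (Cf v) (Cg v)) => // u Au.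
by rewrite -deriveD //; apply: diff_derivable; [exact: df|exact: dg].
Qed.

(** Leibniz' rule: the derivative of the product contains [f] and [g] themselves, whose class is
    lowered by [class_CW] before the induction hypothesis applies. *)
Lemma class_CM A k (f g : 'rV[R]_m -> R) : open A ->
  class_C k A f -> class_C k A g -> class_C k A (fun u => f u * g u).
Proof.
move=> oA; elim: k f g => [|k IH] f g.
  by move=> Cf Cg u Au; apply: (@continuousM _ _ f g); [exact: Cf|exact: Cg].
move=> Cf Cg; have [df {}Cf'] := Cf; have [dg Cg'] := Cg.
split=> [u Au|v].
  by apply: differentiableM; [exact: df|exact: dg].
have H := class_CD oA (IH _ _ (class_CW Cf) (Cg' v))
                     (IH _ _ (class_CW Cg) (Cf' v)).
apply: class_C_ext H => // u Au.
by rewrite -/(f * g) deriveM //; apply: diff_derivable; [exact: df|exact: dg].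
Qed.

Lemma class_CV A k (f : 'rV[R]_m -> R) : open A ->
  (forall u, A u -> f u != 0) -> class_C k A f ->
  class_C k A (fun u => (f u)^-1).
Proof.
move=> oA f0; elim: k => [|k IH].
  by move=> Cf u Au; apply: (@continuousV _ _ f); [exact: f0|exact: Cf].
move=> Cf; have [df Cf'] := Cf; split=> [u Au|v].
  by apply: differentiableV; [exact: df|exact: f0].
have CV := IH (class_CW Cf).
have H := class_CM oA (class_C_cst A k (-1 : R))
  (class_CM oA (class_CM oA CV CV) (Cf' v)).
apply: class_C_ext H => // u Au.
rewrite deriveV; [|exact: f0|by apply: diff_derivable; exact: df].
by rewrite mulN1r expr2 invfM scaleNr.
Qed.

Lemma class_C_sum A W k (I : Type) (r : seq I) (P : pred I)
    (f : I -> 'rV[R]_m -> W) : open A -> (forall i, class_C k A (f i)) ->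
  class_C k A (fun u => \sum_(i <- r | P i) f i u).
Proof.
move=> oA Cf; elim: r => [|i r IH].
  by under eq_fun do rewrite big_nil; exact: class_C_cst.
under eq_fun do rewrite big_cons; case: (P i) => //.
exact: class_CD.
Qed.

Lemma class_C_prod A k (I : Type) (r : seq I) (P : pred I)
    (f : I -> 'rV[R]_m -> R) : open A -> (forall i, class_C k A (f i)) ->
  class_C k A (fun u => \prod_(i <- r | P i) f i u).
Proof.
move=> oA Cf; elim: r => [|i r IH].
  by under eq_fun do rewrite big_nil; exact: class_C_cst.
under eq_fun do rewrite big_cons; case: (P i) => //.
exact: class_CM.
Qed.

Lemma differentiable_mxP (p q : nat) (f : 'rV[R]_m -> 'M[R]_(p, q)) u :
  differentiable f u <-> forall i j, differentiable (fun x => f x i j) u.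
Proof.
split=> [df i j|df].
  apply: (@differentiable_comp _ _ _ _ f (fun M : 'M[R]_(p, q) => M i j : R)) => //.
  exact: differentiable_coord.
rewrite (_ : f = \sum_(i < p) \sum_(j < q) (fun x => f x i j *: delta_mx i j)).
  apply: differentiable_sum => i; apply: differentiable_sum => j.
  exact: differentiableZl.
apply/funext => x; rewrite [LHS]matrix_sum_delta fct_sumE.
by apply: eq_bigr => i _; rewrite fct_sumE.
Qed.

(** Directional derivatives are entrywise, so smoothness of matrix operations reduces to sums and
    products of scalar functions. *)
Lemma class_C_mxP A k (p q : nat) (f : 'rV[R]_m -> 'M[R]_(p, q)) : open A ->
  class_C k A f <-> forall i j, class_C k A (fun x => f x i j).
Proof.
move=> oA; elim: k f => [|k IH] f /=.
  split=> [Cf i j u Au|Cf].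
    apply: (@continuous_comp _ _ _ f (fun M : 'M[R]_(p, q) => M i j)).
      exact: Cf.
    exact: coord_continuous.
  have fE : f = fun x => \sum_i \sum_j f x i j *: delta_mx i j.
    by apply/funext => x; exact: matrix_sum_delta.
  change (class_C 0 A f); rewrite fE.
  apply: class_C_sum => // i; apply: class_C_sum => // j x Ax.
  apply: (@continuous_comp _ _ _ (fun x => f x i j) ( *:%R^~ (delta_mx i j))).
    exact: Cf.
  exact: scalel_continuous.
have dE (df : forall u, A u -> differentiable f u) v i j u : A u ->
    'D_v f u i j = 'D_v (fun x => f x i j) u.
  by move=> Au; rewrite derive_mx ?mxE //; apply: diff_derivable; exact: df.
split=> [[df Cf] i j|Cf].
  split=> [u Au|v]; first by move: i j; apply/differentiable_mxP; exact: df.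
  have /(IH _).1 /(_ i j) := Cf v; apply: class_C_ext => // u Au.
  exact: dE.
have df u : A u -> differentiable f u.
  by move=> Au; apply/differentiable_mxP => i j; have [] := Cf i j => + _; apply.
split=> // v; apply/IH => i j.
have [_ /(_ v)] := Cf i j; apply: class_C_ext => // u Au.
by rewrite dE.
Qed.

Lemma class_C_det A k (p : nat) (f : 'rV[R]_m -> 'M[R]_p) : open A ->
  class_C k A f -> class_C k A (fun u => \det (f u)).
Proof.
move=> oA /(class_C_mxP _ _ oA) Cf; apply: class_C_sum => // s.
apply: class_CM => //; first exact: class_C_cst.
by apply: class_C_prod => // i; exact: Cf.
Qed.

Lemma class_C_mulmx A k (p q r : nat) (f : 'rV[R]_m -> 'M[R]_(p, q))
    (g : 'rV[R]_m -> 'M[R]_(q, r)) : open A ->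
  class_C k A f -> class_C k A g -> class_C k A (fun u => f u *m g u).
Proof.
move=> oA /(class_C_mxP _ _ oA) Cf /(class_C_mxP _ _ oA) Cg.
apply/class_C_mxP => // i j; under eq_fun do rewrite mxE.
by apply: class_C_sum => // l; apply: class_CM; [|exact: Cf|exact: Cg].
Qed.

Lemma class_C_trmx A k (p q : nat) (f : 'rV[R]_m -> 'M[R]_(p, q)) : open A ->
  class_C k A f -> class_C k A (fun u => (f u)^T).
Proof.
move=> oA /(class_C_mxP _ _ oA) Cf; apply/class_C_mxP => // i j.
by under eq_fun do rewrite mxE; exact: Cf.
Qed.

(** Cramer's rule: on [A] the inverse is the adjugate, polynomial in the entries, divided by a
    nonvanishing determinant. *)
Lemma class_C_invmx A k (p : nat) (f : 'rV[R]_m -> 'M[R]_p) : open A ->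
  (forall u, A u -> f u \in unitmx) ->
  class_C k A f -> class_C k A (fun u => invmx (f u)).
Proof.
move=> oA fu Cf.
suff CF : class_C k A (fun u => (\det (f u))^-1 *: \adj (f u)).
  by apply: class_C_ext CF => // u Au; rewrite /invmx fu.
apply/class_C_mxP => // i j; under eq_fun do rewrite !mxE.
apply: class_CM => //.
  apply: class_CV => //; last exact: class_C_det.
  by move=> u /fu; rewrite unitmxE unitfE.
apply: class_CM => //; first exact: class_C_cst.
apply: class_C_det => //; move/(class_C_mxP _ _ oA): Cf => Cf.
by apply/class_C_mxP => // a b; under eq_fun do rewrite !mxE; exact: Cf.
Qed.

Lemma class_CB A W k (f g : 'rV[R]_m -> W) : open A ->
  class_C k A f -> class_C k A g -> class_C k A (fun u => f u - g u).
Proof.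
move=> oA Cf Cg; apply: class_CD => //.
elim: k g Cg {Cf} => [|k IH] g /=.
  by move=> Cg u Au; apply: continuousN; exact: Cg.
move=> [dg Cg]; split=> [u Au|v]; first by apply: differentiableN; exact: dg.
apply: class_C_ext (IH _ (Cg v)) => // u Au.
by rewrite -deriveN //; apply: diff_derivable; exact: dg.
Qed.

End ClassC.

(** * The chain rule and composition of maps of class C^k *)

Section Composition.
Context {R : realType} {m d : nat}.
Implicit Types (A : set 'rV[R]_m) (B : set 'rV[R]_d) (f : 'rV[R]_m -> 'rV[R]_d).

Lemma derive_comp (W : normedModType R) f (h : 'rV[R]_d -> W) u v :
  differentiable f u -> differentiable h (f u) ->
  'D_v (fun x => h (f x)) u = 'D_('D_v f u) h (f u).
Proof.
move=> df dh; rewrite !deriveE //; last exact: differentiable_comp.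
by rewrite (diff_comp df dh).
Qed.

Lemma derive_sum_coord (W : normedModType R) (h : 'rV[R]_d -> W) y v :
  differentiable h y -> 'D_v h y = \sum_l v 0 l *: 'D_(delta_mx 0 l) h y.
Proof.
move=> dh; rewrite deriveE // {1}(row_sum_delta v) linear_sum /=.
by apply: eq_bigr => l _; rewrite linearZ deriveE.
Qed.

(** The induction runs over all [h] at once, because the chain rule brings in the partial
    derivatives of [h] composed with [f]. *)
Lemma class_C_comp A B k f (h : 'rV[R]_d -> R) : open A ->
  (forall u, A u -> B (f u)) -> class_C k A f -> class_C k B h ->
  class_C k A (fun u => h (f u)).
Proof.
move=> oA fAB; elim: k h => [|k IH] h.
  move=> Cf Ch u Au; apply: (@continuous_comp _ _ _ f h); first exact: Cf.
  by apply: Ch; exact: fAB.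
move=> Cf Ch; have [df Cf'] := Cf; have [dh Ch'] := Ch; split=> [u Au|v].
  by apply: differentiable_comp; [exact: df|apply/dh/fAB].
have H : class_C k A
    (fun u => \sum_l 'D_v f u 0 l * 'D_(delta_mx 0 l) h (f u)).
  apply: class_C_sum => // l; apply: class_CM => //.
    by move: (Cf' v) => /(class_C_mxP _ _ oA).
  exact: (IH ('D_(delta_mx 0 l) h) (class_CW Cf) (Ch' _)).
apply: class_C_ext H => // u Au; rewrite derive_comp ?derive_sum_coord //.
- exact/dh/fAB.
- exact: df.
- exact/dh/fAB.
Qed.

Lemma class_C_comp_mx A B k (p q : nat) f (h : 'rV[R]_d -> 'M[R]_(p, q)) :
  open A -> open B -> (forall u, A u -> B (f u)) -> class_C k A f ->
  class_C k B h -> class_C k A (fun u => h (f u)).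
Proof.
move=> oA oB fAB Cf /(class_C_mxP _ _ oB) Ch; apply/class_C_mxP => // i j.
exact: (class_C_comp oA fAB Cf (Ch i j)).
Qed.

End Composition.

(** * Symmetry of second derivatives *)

Section Schwarz.
Context {R : realType} {m : nat}.
Implicit Types (A : set 'rV[R]_m) (h : 'rV[R]_m -> R).

Lemma is_derive_line h (a v : 'rV[R]_m) (s : R) : derivable h (a + s *: v) v ->
  is_derive s 1 (fun s : R => h (a + s *: v)) ('D_v h (a + s *: v)).
Proof.
move=> dh; have E : (fun t : R => t^-1 *:
    (((fun s : R => h (a + s *: v)) \o shift s) (t *: 1) - h (a + s *: v))) =
    (fun t : R => t^-1 *: ((h \o shift (a + s *: v)) (t *: v) - h (a + s *: v))).
  apply/funext => t; congr (_ *: (h _ - _)).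
  by rewrite /= scalerDl [t *: 1]mulr1 addrCA.
by split; rewrite /derivable /derive E.
Qed.

Lemma MVT_line h (a v : 'rV[R]_m) (t : R) : 0 < t ->
  (forall s, 0 <= s <= t -> derivable h (a + s *: v) v) ->
  exists2 s, 0 < s < t & h (a + t *: v) - h a = t * 'D_v h (a + s *: v).
Proof.
move=> t0 dh.
have dl s : 0 <= s <= t ->
    is_derive s 1 (fun s : R => h (a + s *: v)) ('D_v h (a + s *: v)).
  by move=> st; apply: is_derive_line; exact: dh.
have [||s] := @MVT R (fun s => h (a + s *: v)) (fun s => 'D_v h (a + s *: v))
  0 t t0.
- move=> s; rewrite in_itv /= => /andP[s0 st]; apply: dl.
  by rewrite !ltW.
- apply: continuous_in_subspaceT => s; rewrite inE /= in_itv /= => st.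
  apply: differentiable_continuous; apply/derivable1_diffP.
  by have [] := dl _ st.
rewrite in_itv /= => st; rewrite scale0r addr0 subr0 mulrC => E.
by exists s.
Qed.

Lemma derivable_shift h (c x v : 'rV[R]_m) :
  derivable h (x + c) v -> derivable (fun a => h (a + c)) x v.
Proof.
rewrite /derivable /= => dh; under eq_fun do rewrite -addrA; exact: dh.
Qed.

Lemma derive_shift h (c x v : 'rV[R]_m) :
  'D_v (fun a => h (a + c)) x = 'D_v h (x + c).
Proof. by rewrite /derive /=; under eq_fun do rewrite -addrA. Qed.

(* The mean value theorem in each direction turns the second difference of h over
   a small parallelogram into t^2 times a mixed derivative at a nearby point. *)
Lemma schwarz_scalar A h u v w : open A -> A u -> class_C 2 A h ->
  'D_v ('D_w h) u = 'D_w ('D_v h) u.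
Proof.
move=> oA Au Ch; have [dh Ch1] := Ch.
have dd v1 : forall x, A x -> differentiable ('D_v1 h) x by case: (Ch1 v1).
have cc v1 w1 : {for u, continuous ('D_w1 ('D_v1 h))}.
  by have [_ /(_ w1) /(_ _ Au)] := Ch1 v1.
have incr (v1 w1 : 'rV[R]_m) (e : R) : 0 < e -> exists2 del : R, 0 < del &
    forall t : R, 0 < t < del ->
    `|h (u + t *: v1 + t *: w1) - h (u + t *: v1) - h (u + t *: w1) + h u
      - t ^+ 2 * 'D_w1 ('D_v1 h) u| <= t ^+ 2 * e.
  move=> e0.
  have [r r0 near_u] : exists2 r : R, 0 < r & forall y, `|y| < r ->
      A (u + y) /\ `|'D_w1 ('D_v1 h) u - 'D_w1 ('D_v1 h) (u + y)| <= e.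
    have : \forall y \near u, A y /\
        `|'D_w1 ('D_v1 h) u - 'D_w1 ('D_v1 h) y| <= e.
      apply: filterI; first exact: open_nbhs_nbhs.
      have Hc : 'D_w1 ('D_v1 h) y @[y --> u] --> 'D_w1 ('D_v1 h) u := cc v1 w1.
      have /cvgrPdist_le /(_ _ e0) := Hc; exact.
    move=> /nbhs_ballP [r /= r0 rP]; exists r => // y yr; apply: rP.
    by rewrite -ball_normE /= opprD addNKr normrN.
  have [a a0 aE] : exists2 a : R, 0 <= a & `|v1| = a.
    by exists `|v1| => //; exact: normr_ge0.
  have [b b0 bE] : exists2 b : R, 0 <= b & `|w1| = b.
    by exists `|w1| => //; exact: normr_ge0.
  (* The summand 1 keeps the denominator positive when both directions are zero. *)
  have vw0 : 0 < a + b + 1 by rewrite ltr_pwDr // addr_ge0.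
  exists (r / (a + b + 1)) => [|t /andP[t0 tr]]; first exact: divr_gt0.
  have small (s1 s2 : R) : 0 <= s1 <= t -> 0 <= s2 <= t ->
      `|s1 *: v1 + s2 *: w1| < r.
    move=> /andP[s10 s1t] /andP[s20 s2t].
    apply: le_lt_trans (ler_normD _ _) _; rewrite !normrZ aE bE !ger0_norm //.
    move: tr; rewrite ltr_pdivlMr //; apply: le_lt_trans; rewrite !mulrDr.
    by rewrite -[leLHS]addr0; do 2?apply: lerD; rewrite ?mulr1 ?ler_wpM2r // ltW.
  have inA (s1 s2 : R) : 0 <= s1 <= t -> 0 <= s2 <= t ->
      A (u + s1 *: v1 + s2 *: w1).
    by move=> ? ?; rewrite -addrA; apply: (near_u _ _).1; exact: small.
  have tt : 0 <= t <= t by rewrite lexx ltW.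
  have oo : 0 <= (0 : R) <= t by rewrite lexx ltW.
  (* The second difference of [h] is an increment of [g] along [v1]; the mean value theorem is used
     along [v1] for [g], then along [w1] for the derivative of [h] in the direction [v1]. *)
  pose g (a : 'rV[R]_m) := h (a + t *: w1) - h a.
  have dg (s : R) : 0 <= s <= t -> derivable g (u + s *: v1) v1.
    move=> st; apply: derivableB.
      by apply: derivable_shift; apply/diff_derivable/dh/inA.
    by apply/diff_derivable/dh; have := inA s 0 st oo; rewrite scale0r addr0.
  have [s /andP[s0 st] gE] := MVT_line t0 dg.
  have st' : 0 <= s <= t by rewrite !ltW.
  have Dg : 'D_v1 g (u + s *: v1) =
      'D_v1 h (u + s *: v1 + t *: w1) - 'D_v1 h (u + s *: v1).
    rewrite deriveB ?derive_shift //.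
      by apply: derivable_shift; apply/diff_derivable/dh/inA.
    by apply/diff_derivable/dh; have := inA s 0 st' oo; rewrite scale0r addr0.
  have [s2 /andP[s20 s2t] hE] := MVT_line t0 (fun s2 s2t =>
    @diff_derivable _ _ _ _ _ w1 (dd v1 _ (inA s s2 st' s2t))).
  move: gE; rewrite Dg hE /g => gE.
  have -> : h (u + t *: v1 + t *: w1) - h (u + t *: v1) - h (u + t *: w1) + h u
      = t ^+ 2 * 'D_w1 ('D_v1 h) (u + s *: v1 + s2 *: w1).
    by rewrite expr2 -mulrA -gE opprB !addrA [RHS]addrAC.
  rewrite -mulrBr normrM ger0_norm ?sqr_ge0 // ler_pM2l ?exprn_gt0 // distrC.
  by rewrite -addrA; apply: (near_u _ _).2; apply: small; rewrite // !ltW.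
have two_thirds (z : R) : 0 < z -> 2 * (z / 3) < z by clear; lra.
apply/eqP/negPn/negP => neq.
(* The second difference is symmetric in the two directions, so the mixed derivatives differ by at
   most 2e. With e a third of their distance this is a contradiction. *)
pose e := `|'D_v ('D_w h) u - 'D_w ('D_v h) u| / 3.
have e0 : 0 < e by rewrite divr_gt0 // normr_gt0 subr_eq0.
have [d1 d10 dP1] := incr v w e e0; have [d2 d20 dP2] := incr w v e e0.
pose t := Num.min d1 d2 / 2.
have t0 : 0 < t by rewrite divr_gt0 // lt_min d10.
have tm : t < Num.min d1 d2.
  by rewrite ltr_pdivrMr // ltr_pMr ?ltr1n // lt_min d10.
have H1 : `|h (u + t *: v + t *: w) - h (u + t *: v) - h (u + t *: w) + h u
      - t ^+ 2 * 'D_w ('D_v h) u| <= t ^+ 2 * e.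
  by apply: dP1; rewrite t0 (lt_le_trans tm) // ge_min lexx.
have H2 : `|h (u + t *: w + t *: v) - h (u + t *: w) - h (u + t *: v) + h u
      - t ^+ 2 * 'D_v ('D_w h) u| <= t ^+ 2 * e.
  by apply: dP2; rewrite t0 (lt_le_trans tm) // ge_min lexx orbT.
have : `|'D_v ('D_w h) u - 'D_w ('D_v h) u| * t ^+ 2 <= t ^+ 2 * (2 * e).
  have -> : t ^+ 2 * (2 * e) = t ^+ 2 * e + t ^+ 2 * e by ring.
  have -> : `|'D_v ('D_w h) u - 'D_w ('D_v h) u| * t ^+ 2 =
      `|('D_v ('D_w h) u - 'D_w ('D_v h) u) * t ^+ 2|.
    by rewrite normrM (@ger0_norm _ (t ^+ 2)) ?sqr_ge0.
  rewrite [u + t *: w + _]addrAC in H2; rewrite -normrN in H2.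
  apply: le_trans (lerD H1 H2); apply: le_trans (ler_normD _ _).
  move: ('D_v ('D_w h) u) ('D_w ('D_v h) u) (h _) (h _) (h _) (h _) => *.
  rewrite le_eqVlt; apply/orP; left; apply/eqP; congr (`|_|); ring.
rewrite mulrC ler_pM2l ?exprn_gt0 // /e; apply/negP; rewrite -ltNge.
have : 0 < `|'D_v ('D_w h) u - 'D_w ('D_v h) u| by rewrite normr_gt0 subr_eq0.
exact: two_thirds.
Qed.

Lemma schwarz_mx (p q : nat) A (h : 'rV[R]_m -> 'M[R]_(p, q)) u v w :
  open A -> A u -> class_C 2 A h -> 'D_v ('D_w h) u = 'D_w ('D_v h) u.
Proof.
move=> oA Au Ch; have [dh Ch1] := Ch.
have dd v1 : differentiable ('D_v1 h) u by have [+ _] := Ch1 v1; apply.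
move/(class_C_mxP _ _ oA) : Ch => Ch; apply/matrixP => i j.
have E v1 w1 : 'D_w1 ('D_v1 h) u i j = 'D_w1 ('D_v1 (fun x => h x i j)) u.
  rewrite derive_mx ?mxE; last exact: diff_derivable.
  apply: near_eq_derive; apply: (filterS (P := A)); last exact: open_nbhs_nbhs.
  by move=> x Ax; rewrite derive_mx ?mxE //; apply: diff_derivable; exact: dh.
transitivity ('D_v ('D_w (fun x => h x i j)) u); first exact: E.
rewrite (schwarz_scalar v w oA Au (Ch i j)); exact: (esym (E _ _)).
Qed.

End Schwarz.

(** * Derivatives of products and transposes of matrices *)

Section MatrixDerivative.
Context {R : realType} {m : nat}.
Local Notation V := 'rV[R]_m.

Lemma differentiable_mulmx (p q r : nat) (f : V -> 'M[R]_(p, q))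
    (g : V -> 'M[R]_(q, r)) u : differentiable f u -> differentiable g u ->
  differentiable (fun x => f x *m g x) u.
Proof.
move=> /differentiable_mxP df /differentiable_mxP dg.
apply/differentiable_mxP => i j; under eq_fun do rewrite mxE.
rewrite (_ : (fun _ => _) = \sum_l (fun x => f x i l * g x l j)); last first.
  by apply/funext => x; rewrite fct_sumE.
apply: differentiable_sum => l.
exact: (@differentiableM _ _ (fun x => f x i l) (fun x => g x l j)).
Qed.

Lemma derive_mulmx (p q r : nat) (f : V -> 'M[R]_(p, q))
    (g : V -> 'M[R]_(q, r)) u v : differentiable f u -> differentiable g u ->
  'D_v (fun x => f x *m g x) u = 'D_v f u *m g u + f u *m 'D_v g u.
Proof.
move=> df dg.
have dfg : derivable (fun x => f x *m g x) u v.
  by apply: diff_derivable; exact: differentiable_mulmx.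
have ddf : derivable f u v := diff_derivable df.
have ddg : derivable g u v := diff_derivable dg.
apply/matrixP => i j; rewrite (derive_mx dfg) (derive_mx ddf) (derive_mx ddg).
have df' k : derivable (fun x => f x i k) u v by move: i k; apply/derivable_mxP.
have dg' k : derivable (fun x => g x k j) u v by move: k j; apply/derivable_mxP.
rewrite !mxE -big_split /=.
have -> : (fun x => (f x *m g x) i j) =
    \sum_k (fun x => f x i k) * (fun x => g x k j).
  by apply/funext => x; rewrite fct_sumE mxE.
rewrite derive_sum; last by move=> k; exact: derivableM.
apply: eq_bigr => k _; rewrite deriveM // !mxE addrC.
by congr (_ + _); exact: mulrC.
Qed.

Lemma derive_trmx (p q : nat) (f : V -> 'M[R]_(p, q)) u v :
  differentiable f u -> 'D_v (fun x => (f x)^T) u = ('D_v f u)^T.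
Proof.
move=> df.
have ddf : derivable f u v := diff_derivable df.
have ddT : derivable (fun x => (f x)^T) u v.
  apply/derivable_mxP => i j; under eq_fun do rewrite mxE.
  by move: j i; apply/derivable_mxP.
apply/matrixP => i j; rewrite (derive_mx ddT) (derive_mx ddf) !mxE.
by congr ('D_v _ u); apply/funext => x; rewrite mxE.
Qed.

Lemma differentiable_trmx (p q : nat) (f : V -> 'M[R]_(p, q)) u :
  differentiable f u -> differentiable (fun x => (f x)^T) u.
Proof.
move=> df; apply/differentiable_mxP => i j; under eq_fun do rewrite mxE.
by move: j i; apply/differentiable_mxP.
Qed.

End MatrixDerivative.

Section SmoothOn.
Context {R : realType} {m : nat}.
Implicit Types (A : set 'rV[R]_m) (W : normedModType R).

Lemma smooth_on_derive A W (f : 'rV[R]_m -> W) v :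
  smooth_on A f -> smooth_on A ('D_v f).
Proof. by move=> sf k; have [_] := sf k.+1; apply. Qed.

Lemma smooth_on_differentiable A W (f : 'rV[R]_m -> W) u :
  smooth_on A f -> A u -> differentiable f u.
Proof. by move=> sf Au; have [+ _] := sf 1; apply. Qed.

Lemma derive_entry (p q : nat) (f : 'rV[R]_m -> 'M[R]_(p, q)) u v i j :
  differentiable f u -> 'D_v (fun x => f x i j) u = 'D_v f u i j.
Proof.
move=> df; have ddf : derivable f u v := diff_derivable df.
by rewrite (derive_mx ddf) mxE.
Qed.

Lemma deriveDl W (f : 'rV[R]_m -> W) u v w : differentiable f u ->
  'D_(v + w) f u = 'D_v f u + 'D_w f u.
Proof. by move=> df; rewrite !deriveE // linearD. Qed.

Lemma deriveZdir W (f : 'rV[R]_m -> W) u a v : differentiable f u ->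
  'D_(a *: v) f u = a *: 'D_v f u.
Proof. by move=> df; rewrite !deriveE // linearZ. Qed.

End SmoothOn.

(** * The Levi-Civita connection of a metric in coordinates *)

Section Inner.
Context {R : realType} {d : nat}.
Implicit Types (B : 'M[R]_d) (v w : 'rV[R]_d).

Lemma innerDl B v1 v2 w : inner B (v1 + v2) w = inner B v1 w + inner B v2 w.
Proof. by rewrite /inner !mulmxDl mxE. Qed.

Lemma innerDr B v w1 w2 : inner B v (w1 + w2) = inner B v w1 + inner B v w2.
Proof. by rewrite /inner linearD mulmxDr mxE. Qed.

Lemma innerNl B v w : inner B (- v) w = - inner B v w.
Proof. by rewrite /inner !mulNmx mxE. Qed.

Lemma innerNr B v w : inner B v (- w) = - inner B v w.
Proof. by rewrite /inner linearN mulmxN mxE. Qed.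

Lemma innerZl B a v w : inner B (a *: v) w = a * inner B v w.
Proof. by rewrite /inner -!scalemxAl mxE. Qed.

Lemma innerZr B a v w : inner B v (a *: w) = a * inner B v w.
Proof. by rewrite /inner linearZ -scalemxAr mxE. Qed.

Lemma innerDm B1 B2 v w : inner (B1 + B2) v w = inner B1 v w + inner B2 v w.
Proof. by rewrite /inner mulmxDr mulmxDl mxE. Qed.

Lemma innerZm a B v w : inner (a *: B) v w = a * inner B v w.
Proof. by rewrite /inner -scalemxAr -scalemxAl mxE. Qed.

Lemma innerNm B v w : inner (- B) v w = - inner B v w.
Proof. by rewrite /inner mulmxN mulNmx mxE. Qed.

Lemma inner0l B w : inner B 0 w = 0.
Proof. by rewrite /inner !mul0mx mxE. Qed.

Lemma inner0r B v : inner B v 0 = 0.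
Proof. by rewrite /inner trmx0 mulmx0 mxE. Qed.

Lemma inner_sumr B (I : finType) (a : I -> R) (v : I -> 'rV[R]_d) w :
  inner B w (\sum_i a i *: v i) = \sum_i a i * inner B w (v i).
Proof.
apply: (big_rec2 (fun x y => inner B w x = y)); first exact: inner0r.
by move=> i x y _ <-; rewrite innerDr innerZr.
Qed.

Lemma inner_summ (I : finType) (a : I -> R) (B : I -> 'M[R]_d) v w :
  inner (\sum_i a i *: B i) v w = \sum_i a i * inner (B i) v w.
Proof.
apply: (big_rec2 (fun x y => inner x v w = y)).
  by rewrite /inner mulmx0 mul0mx mxE.
by move=> i x y _ <-; rewrite innerDm innerZm.
Qed.

Lemma inner_trmx B v w : inner B^T v w = inner B w v.
Proof.
have -> : inner B w v = (w *m B *m v^T)^T 0 0 by rewrite mxE.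
by rewrite !trmx_mul trmxK mulmxA.
Qed.

Lemma innerC B v w : B^T = B -> inner B v w = inner B w v.
Proof. by move=> BT; rewrite -inner_trmx BT. Qed.

Lemma inner_delta B i j : inner B (delta_mx 0 i) (delta_mx 0 j) = B i j.
Proof. by rewrite /inner -rowE trmx_delta -colE !mxE. Qed.

Lemma inner_delta_r B (v : 'rV[R]_d) j : inner B v (delta_mx 0 j) = (v *m B) 0 j.
Proof. by rewrite /inner trmx_delta -colE mxE. Qed.

Lemma innerI B v w : B \in unitmx -> (forall z, inner B v z = inner B w z) ->
  v = w.
Proof.
move=> uB E; rewrite -[v](mulmxK uB) -[w](mulmxK uB); congr (_ *m _).
by apply/rowP => j; rewrite -!inner_delta_r.
Qed.

Lemma inner_coordr B v w :
  inner B v w = \sum_l w 0 l * inner B v (delta_mx 0 l).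
Proof. by rewrite {1}(row_sum_delta w) inner_sumr. Qed.

Lemma inner_matrixP B1 B2 : (forall v w, inner B1 v w = inner B2 v w) -> B1 = B2.
Proof. by move=> E; apply/matrixP => i j; rewrite -!inner_delta. Qed.

Lemma pos_unitmx B : (forall v, v != 0 -> 0 < inner B v v) -> B \in unitmx.
Proof.
move=> pB; rewrite -row_free_unit -kermx_eq0; apply/rowV0P => v /sub_kermxP vB.
apply/eqP/negP => /negP /pB; by rewrite /inner vB mul0mx mxE ltxx.
Qed.

End Inner.

(* [B] stands for the metric at a point and [dB v] for its derivative in the
   direction [v], so that [chris B dB] is [christoffel]. *)
Section ChristoffelAlgebra.
Context {R : realType} {d : nat}.
Variables (B : 'M[R]_d) (dB : 'rV[R]_d -> 'M[R]_d).
Hypothesis uB : B \in unitmx.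
Hypothesis symB : B^T = B.
Hypothesis symdB : forall v, (dB v)^T = dB v.
Hypothesis dBD : forall v w, dB (v + w) = dB v + dB w.
Hypothesis dBZ : forall a v, dB (a *: v) = a *: dB v.
Implicit Types (v w z : 'rV[R]_d).

Definition chris v w : 'rV[R]_d :=
  (\row_l (2^-1 * (inner (dB v) w (delta_mx 0 l)
                 + inner (dB w) v (delta_mx 0 l)
                 - inner (dB (delta_mx 0 l)) v w))) *m invmx B.

(** Koszul's formula for constant coefficient fields. The definition tests it on basis vectors;
    linearity of [dB] in its direction extends it to every [z]. *)
Lemma inner_chris v w z : inner B (chris v w) z =
  2^-1 * (inner (dB v) w z + inner (dB w) v z - inner (dB z) v w).
Proof.
have dBz : dB z = \sum_l z 0 l *: dB (delta_mx 0 l).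
  rewrite {1}(row_sum_delta z); apply: (big_rec2 (fun x y => dB x = y)).
    by rewrite -[X in dB X](scale0r 0) dBZ scale0r.
  by move=> i x y _ <-; rewrite dBD dBZ.
rewrite {1}/inner mulmxKV // mxE (inner_coordr (dB v)) (inner_coordr (dB w)).
rewrite dBz inner_summ -sumrN -!big_split /= mulr_sumr; apply: eq_bigr => l _.
by rewrite !mxE mulrC mulrCA -mulrDr -mulrBr.
Qed.

Lemma chrisC v w : chris v w = chris w v.
Proof.
apply: (innerI uB) => z; rewrite !inner_chris (innerC v w) //.
by rewrite [inner (dB v) _ _ + _]addrC.
Qed.

Lemma chrisDr v w1 w2 : chris v (w1 + w2) = chris v w1 + chris v w2.
Proof.
apply: (innerI uB) => z; rewrite innerDl !inner_chris dBD innerDm innerDl innerDr.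
ring.
Qed.

Lemma chrisZr v a w : chris v (a *: w) = a *: chris v w.
Proof.
apply: (innerI uB) => z; rewrite innerZl !inner_chris dBZ innerZm innerZl innerZr.
by rewrite [RHS]mulrCA; congr (_ * _); rewrite mulrBr mulrDr.
Qed.

(** The connection form evaluated on [v]: row b is the covariant derivative of the b-th coordinate
    field along [v]. *)
Definition chris_mx v : 'M[R]_d := \matrix_b chris v (delta_mx 0 b).

Lemma chrisE v w : chris v w = w *m chris_mx v.
Proof.
rewrite mulmx_sum_row {1}(row_sum_delta w).
under [RHS]eq_bigr do rewrite rowK.
apply: (big_rec2 (fun a b => chris v a = b)).
  by rewrite -[X in chris _ X](scale0r 0) chrisZr scale0r.
by move=> i a b _ <-; rewrite chrisDr chrisZr.
Qed.

Lemma chris_mx_sum v : chris_mx v = \sum_a v 0 a *: chris_mx (delta_mx 0 a).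
Proof.
apply/row_matrixP => b; rewrite rowK chrisC chrisE mulmx_sum_row linear_sum.
by apply: eq_bigr => a _; rewrite linearZ /= !rowK chrisC.
Qed.

(** Compatibility of the connection with the metric: in the sum of the two Koszul expressions, the
    derivatives of the metric in the directions of the arguments cancel. *)
Lemma chris_compat v : dB v = chris_mx v *m B + B *m (chris_mx v)^T.
Proof.
apply: inner_matrixP => a b; rewrite innerDm.
have -> : inner (chris_mx v *m B) a b = inner B (chris v a) b.
  by rewrite chrisE /inner !mulmxA.
have -> : inner (B *m (chris_mx v)^T) a b = inner B (chris v b) a.
  by rewrite (innerC _ _ symB) chrisE /inner trmx_mul !mulmxA.
rewrite !inner_chris (innerC v a (symdB b)) (innerC v b (symdB a)).
rewrite (innerC b a (symdB v)).
lra.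
Qed.

Variable J : 'M[R]_d.
Hypothesis JJ : J *m J = - 1%:M.
Hypothesis JB : forall v w, inner B (v *m J) (w *m J) = inner B v w.
Hypothesis JdB : forall z v w, inner (dB z) (v *m J) (w *m J) = inner (dB z) v w.
Hypothesis closed : forall v w z, inner (dB v) (w *m J) z
  + inner (dB w) (z *m J) v + inner (dB z) (v *m J) w = 0.

(* Closedness of the fundamental form at (v, w, z) and at (v, Jw, Jz), combined
   with the invariance of the metric under J. *)
Lemma chris_complex v w : chris v (w *m J) = chris v w *m J.
Proof.
have JJv (u : 'rV[R]_d) : u *m J *m J = - u.
  by rewrite -mulmxA JJ mulmxN mulmx1.
have skew z a b : inner (dB z) (a *m J) b = - inner (dB z) a (b *m J).
  by rewrite -(JdB z (a *m J) b) JJv innerNl.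
have skewB a b : inner B (a *m J) b = - inner B a (b *m J).
  by rewrite -(JB (a *m J) b) JJv innerNl.
apply: (innerI uB) => z; rewrite skewB !inner_chris.
have := closed w z v; have := closed (w *m J) (z *m J) v.
rewrite !JJv !innerNl JdB !skew.
rewrite (innerC z v (symdB (w *m J))) (innerC z (v *m J) (symdB w)) skew.
lra.
Qed.

End ChristoffelAlgebra.

(** * The connection of a smooth metric on an open set *)

Section Metric.
Context {R : realType} {d : nat}.
Variables (D : set 'rV[R]_d) (G : 'rV[R]_d -> 'M[R]_d).
Hypothesis oD : open D.
Hypothesis sG : smooth_on D G.
Hypothesis symG : forall y, D y -> (G y)^T = G y.
Hypothesis posG : forall y, D y -> forall v, v != 0 -> 0 < inner (G y) v v.
Implicit Types (v w z X Y Z W : 'rV[R]_d).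

Let dG y : D y -> differentiable G y.
Proof. exact: smooth_on_differentiable. Qed.

Let nbhsD y : D y -> nbhs y D.
Proof. by move=> Dy; exact: open_nbhs_nbhs. Qed.

Lemma metric_unit y : D y -> G y \in unitmx.
Proof. by move=> Dy; apply: pos_unitmx; exact: posG. Qed.

Lemma metric_derive_sym y v : D y -> ('D_v G y)^T = 'D_v G y.
Proof.
move=> Dy; rewrite -derive_trmx; last exact: dG.
by apply: near_eq_derive; apply: filterS (nbhsD Dy) => x; exact: symG.
Qed.

Let dGD y : D y -> forall v w, 'D_(v + w) G y = 'D_v G y + 'D_w G y.
Proof. by move=> Dy v w; exact: deriveDl (dG Dy). Qed.

Let dGZ y : D y -> forall a v, 'D_(a *: v) G y = a *: 'D_v G y.
Proof. by move=> Dy a v; exact: deriveZdir (dG Dy). Qed.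

Definition conn y v : 'M[R]_d := chris_mx (G y) (fun v => 'D_v G y) v.

Lemma christoffelC y v w : D y -> christoffel G y v w = christoffel G y w v.
Proof.
move=> Dy; exact: (@chrisC _ _ (G y) (fun v => 'D_v G y) (metric_unit Dy)
  (fun v => metric_derive_sym v Dy) (dGD Dy) (dGZ Dy)).
Qed.

Lemma christoffelE y v w : D y -> christoffel G y v w = w *m conn y v.
Proof.
move=> Dy; exact: (@chrisE _ _ (G y) (fun v => 'D_v G y) (metric_unit Dy)
  (dGD Dy) (dGZ Dy)).
Qed.

Lemma conn_sum y v : D y -> conn y v = \sum_a v 0 a *: conn y (delta_mx 0 a).
Proof.
move=> Dy; exact: (@chris_mx_sum _ _ (G y) (fun v => 'D_v G y) (metric_unit Dy)
  (fun v => metric_derive_sym v Dy) (dGD Dy) (dGZ Dy)).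
Qed.

Lemma metric_compat y v : D y ->
  'D_v G y = conn y v *m G y + G y *m (conn y v)^T.
Proof.
move=> Dy; exact: (@chris_compat _ _ (G y) (fun v => 'D_v G y) (metric_unit Dy)
  (symG Dy) (fun v => metric_derive_sym v Dy) (dGD Dy) (dGZ Dy)).
Qed.

Lemma smooth_christoffel v w : smooth_on D (fun y => christoffel G y v w).
Proof.
have cst_mx k p q (M : 'M[R]_(p, q)) : class_C k D (fun=> M) := class_C_cst D k M.
move=> k; apply: class_C_mulmx => //; last first.
  by apply: class_C_invmx => // y; exact: metric_unit.
have sD v1 a b : class_C k D (fun y => inner ('D_v1 G y) a b).
  suff H : class_C k D (fun y => a *m 'D_v1 G y *m b^T).
    exact: ((class_C_mxP _ _ oD).1 H 0 0).
  apply: class_C_mulmx => //; apply: class_C_mulmx => //.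
  exact: smooth_on_derive.
apply/class_C_mxP => // i l; under eq_fun do rewrite mxE.
apply: class_CM => //; first exact: class_C_cst.
by apply: class_CB => //; apply: class_CD.
Qed.

Lemma smooth_conn v : smooth_on D (conn ^~ v).
Proof.
move=> k; apply/class_C_mxP => // i j; under eq_fun do rewrite mxE.
exact: ((class_C_mxP _ _ oD).1 (smooth_christoffel v _ k) 0 j).
Qed.

End Metric.

(** * Vector fields along a map and the curvature tensor *)

Lemma smooth_id {R : realType} {m : nat} (A : set 'rV[R]_m) :
  smooth_on A (id : 'rV[R]_m -> 'rV[R]_m).
Proof.
case=> [|k]; first by move=> u _; exact: cvg_id.
split=> [u _|v]; first exact: ex_diff.
rewrite (_ : 'D_v id = fun=> v); first exact: class_C_cst.
by apply/funext => u; exact: derive_id.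
Qed.

Lemma derive_row {R : realType} {m p q : nat} (M : 'rV[R]_m -> 'M[R]_(p, q))
  u v b : differentiable M u -> 'D_v (fun x => row b (M x)) u = row b ('D_v M u).
Proof.
move=> dM; have dr : differentiable (fun x => row b (M x)) u.
  apply/differentiable_mxP => i j; under eq_fun do rewrite mxE.
  by move: b j; apply/differentiable_mxP.
apply/rowP => j; rewrite -(derive_entry v 0 j dr) mxE -(derive_entry v b j dM).
by congr ('D_v _ u); apply/funext => x; rewrite mxE.
Qed.

(** [c1] and [c2] are the two second covariant derivatives of a field with value [c] and first
    derivatives [a], [b]; [A] and [B] are the connection matrices along the two directions, [S] and
    [Q] their crossed derivatives. *)
Lemma commutator_algebra {R : realType} {d : nat} (c1 c2 P P' a b c : 'rV[R]_d)
    (Q S A B : 'M[R]_d) :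
  c1 = P + (a *m B + c *m Q) + (b + c *m B) *m A ->
  c2 = P' + (b *m A + c *m S) + (a + c *m A) *m B -> P = P' ->
  c1 - c2 = c *m (Q - S + B *m A - A *m B).
Proof.
move=> -> -> ->; rewrite !mulmxDr !mulmxDl !mulmxN !mulmxA.
by apply/matrixP => i j; rewrite !mxE; ring.
Qed.

Section FieldsAlong.
Context {R : realType} {d n : nat}.
Variables (D : set 'rV[R]_d) (G : 'rV[R]_d -> 'M[R]_d).
Hypothesis oD : open D.
Hypothesis sG : smooth_on D G.
Hypothesis symG : forall y, D y -> (G y)^T = G y.
Hypothesis posG : forall y, D y -> forall v, v != 0 -> 0 < inner (G y) v v.
Variables (U : set 'rV[R]_n) (f : 'rV[R]_n -> 'rV[R]_d).
Hypothesis oU : open U.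
Hypothesis sf : smooth_on U f.
Hypothesis fUD : forall u, U u -> D (f u).
Implicit Types (u v X Y : 'rV[R]_n) (xi : 'rV[R]_n -> 'rV[R]_d).

(** The connection form of the tangent bundle pulled back by [f]. For [f] the identity it is the
    ambient connection, which is how the curvature tensor is treated below. *)
Definition pull_conn v u : 'M[R]_d := conn G (f u) ('D_v f u).

(* [Xi] is a p-tuple of vector fields along [f], written as the rows of a matrix. *)
Definition covD {p : nat} v (Xi : 'rV[R]_n -> 'M[R]_(p, d)) u : 'M[R]_(p, d) :=
  'D_v Xi u + Xi u *m pull_conn v u.

Let nbhsU u : U u -> nbhs u U.
Proof. by move=> Uu; exact: open_nbhs_nbhs. Qed.

Let df u : U u -> differentiable f u.
Proof. exact: smooth_on_differentiable. Qed.

Lemma covderivE v xi u : U u -> covderiv G f v xi u = covD v xi u.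
Proof. by move=> /fUD Dfu; congr (_ + _); exact: (christoffelE sG posG). Qed.

Lemma covD_ext {p : nat} v (Xi Eta : 'rV[R]_n -> 'M[R]_(p, d)) u : U u ->
  (forall x, U x -> Xi x = Eta x) -> covD v Xi u = covD v Eta u.
Proof.
move=> Uu E; have DE : 'D_v Xi u = 'D_v Eta u.
  by apply: near_eq_derive; apply: filterS (nbhsU Uu).
by rewrite /covD (E _ Uu) DE.
Qed.

Lemma differentiable_metric_along u : U u -> differentiable (fun x => G (f x)) u.
Proof.
move=> Uu; apply: differentiable_comp; first exact: df.
by apply: (smooth_on_differentiable sG); exact: fUD.
Qed.

Lemma derive_metric_along v u : U u -> 'D_v (fun x => G (f x)) u =
  pull_conn v u *m G (f u) + G (f u) *m (pull_conn v u)^T.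
Proof.
move=> Uu; rewrite (derive_comp v (df Uu)); last first.
  by apply: (smooth_on_differentiable sG); exact: fUD.
exact: (metric_compat oD sG symG posG _ (fUD Uu)).
Qed.

(** The derivative of [G] along [f] supplies exactly the connection terms that complete the two
    ordinary derivatives to covariant ones. The matrix form allows [Eta] to be the Jacobian, that
    is, all coordinate fields at once. *)
Lemma covD_compat {p q : nat} v (Xi : 'rV[R]_n -> 'M[R]_(p, d))
    (Eta : 'rV[R]_n -> 'M[R]_(q, d)) u : U u ->
  differentiable Xi u -> differentiable Eta u ->
  'D_v (fun x => Xi x *m G (f x) *m (Eta x)^T) u =
  covD v Xi u *m G (f u) *m (Eta u)^T + Xi u *m G (f u) *m (covD v Eta u)^T.
Proof.
move=> Uu dXi dEta; have dGf := differentiable_metric_along Uu.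
have dXG := differentiable_mulmx dXi dGf.
rewrite (derive_mulmx v dXG (differentiable_trmx dEta)) (derive_mulmx v dXi dGf).
rewrite (derive_trmx v dEta) (derive_metric_along v Uu) /covD.
move: ('D_v Xi u) ('D_v Eta u) (pull_conn v u) (G (f u)) => X' E' A B.
move: (Xi u) (Eta u) => X E.
rewrite [(_ + _)^T]linearD /= trmx_mul !mulmxDl !mulmxDr !mulmxDl !mulmxA -!addrA.
by rewrite [X *m B *m A^T *m E^T + _]addrC.
Qed.

(** Symmetry of the Christoffel symbols trades the moving direction ['D_v f u] for the fixed
    [delta_mx 0 b]. What remains is a derivative of [f] times a function of [f u], which can be
    differentiated by the product and chain rules. *)
Lemma row_pull_conn v u b : U u ->
  row b (pull_conn v u) = 'D_v f u *m conn G (f u) (delta_mx 0 b).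
Proof.
move=> /fUD Dfu; rewrite rowE -(christoffelE sG posG) //.
by rewrite (christoffelC oD sG symG posG) // (christoffelE sG posG).
Qed.

Let rowB (p q : nat) (M N : 'M[R]_(p, q)) b : row b (M - N) = row b M - row b N.
Proof. exact: linearB. Qed.

Let sconn w : smooth_on D (conn G ^~ w).
Proof. exact: (smooth_conn oD sG posG). Qed.

Lemma smooth_pull_conn v : smooth_on U (pull_conn v).
Proof.
move=> k; apply/class_C_mxP => // b j.
have H : class_C k U (fun u => 'D_v f u *m conn G (f u) (delta_mx 0 b)).
  apply: class_C_mulmx => //; first exact: smooth_on_derive.
  exact: (class_C_comp_mx oU oD fUD (sf k) (sconn _ k)).
have := (class_C_mxP _ _ oU).1 H 0 j; apply: class_C_ext => // u Uu.
by rewrite -row_pull_conn // mxE.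
Qed.

Lemma derive_pull_conn X Y u b : U u -> row b ('D_X (pull_conn Y) u) =
  'D_X ('D_Y f) u *m conn G (f u) (delta_mx 0 b) +
  'D_Y f u *m 'D_('D_X f u) (conn G ^~ (delta_mx 0 b)) (f u).
Proof.
move=> Uu; have dC : differentiable (conn G ^~ (delta_mx 0 b)) (f u).
  exact: smooth_on_differentiable (sconn _) (fUD Uu).
rewrite -(derive_row X b (smooth_on_differentiable (smooth_pull_conn Y) Uu)).
have -> : 'D_X (fun x => row b (pull_conn Y x)) u =
    'D_X (fun x => 'D_Y f x *m conn G (f x) (delta_mx 0 b)) u.
  apply: near_eq_derive; apply: filterS (nbhsU Uu) => x Ux.
  exact: row_pull_conn.
have dfY : differentiable ('D_Y f) u.
  exact: smooth_on_differentiable (smooth_on_derive Y sf) Uu.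
rewrite (derive_mulmx X dfY (differentiable_comp (df Uu) dC)).
by rewrite (derive_comp X (df Uu) dC).
Qed.

(** The curvature form dω + ω ∧ ω, with the commutator in the order imposed by right multiplication.
    Rows are taken with [conn] in fixed directions, so that [V] and [W] enter as mere vectors. *)
Definition curv_mx y (V W : 'rV[R]_d) : 'M[R]_d :=
  \matrix_b (W *m 'D_V (conn G ^~ (delta_mx 0 b)) y
           - V *m 'D_W (conn G ^~ (delta_mx 0 b)) y)
  + conn G y W *m conn G y V - conn G y V *m conn G y W.

(** The curvature of the pulled back connection is the pulled back curvature: the second derivatives
    of [f] are symmetric in [X] and [Y] and cancel. *)
Lemma curv_mx_pull X Y u : U u ->
  'D_X (pull_conn Y) u - 'D_Y (pull_conn X) u
  + pull_conn Y u *m pull_conn X u - pull_conn X u *m pull_conn Y u =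
  curv_mx (f u) ('D_X f u) ('D_Y f u).
Proof.
move=> Uu; rewrite /curv_mx; congr (_ + _ - _).
apply/row_matrixP => b; rewrite rowK rowB.
have cancel (r1 r2 p p' q1 q2 : 'rV[R]_d) :
    r1 = p + q1 -> r2 = p' + q2 -> p = p' -> r1 - r2 = q1 - q2.
  by move=> -> -> ->; rewrite opprD addrACA subrr add0r.
apply: cancel (derive_pull_conn X Y b Uu) (derive_pull_conn Y X b Uu) _.
exact: (congr1 (mulmx^~ _) (schwarz_mx X Y oU Uu (sf 2))).
Qed.

Lemma smooth_covD {p : nat} v (Xi : 'rV[R]_n -> 'M[R]_(p, d)) :
  smooth_on U Xi -> smooth_on U (covD v Xi).
Proof.
move=> sXi k; apply: class_CD => //; first exact: smooth_on_derive.
by apply: class_C_mulmx => //; exact: smooth_pull_conn.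
Qed.

Lemma covD_commutator X Y xi u : U u -> smooth_on U xi ->
  covD X (covD Y xi) u - covD Y (covD X xi) u =
  xi u *m curv_mx (f u) ('D_X f u) ('D_Y f u).
Proof.
move=> Uu sxi; rewrite -curv_mx_pull //.
have dxi := smooth_on_differentiable sxi Uu.
have E V W : 'D_V (covD W xi) u =
    'D_V ('D_W xi) u + ('D_V xi u *m pull_conn W u + xi u *m 'D_V (pull_conn W) u).
  have dA : differentiable (pull_conn W) u.
    exact: smooth_on_differentiable (smooth_pull_conn W) Uu.
  have dW := smooth_on_differentiable (smooth_on_derive W sxi) Uu.
  have dm := differentiable_mulmx dxi dA.
  rewrite -(derive_mulmx V dxi dA).
  exact: (deriveD (diff_derivable dW) (diff_derivable dm)).
have C V W : covD V (covD W xi) u = ('D_V ('D_W xi) u +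
    ('D_V xi u *m pull_conn W u + xi u *m 'D_V (pull_conn W) u)) +
    ('D_W xi u + xi u *m pull_conn W u) *m pull_conn V u.
  by rewrite {1}/covD; congr (_ + _); exact: E.
exact: (@commutator_algebra _ _ _ _ _ _ _ _ _ _ _ _ _ (C X Y) (C Y X)
  (schwarz_mx X Y oU Uu (sxi 2))).
Qed.

End FieldsAlong.

(** [c1] and [c2] are the two mixed second derivatives of the metric [g], computed from g' = A g + g
    A^T. Their equality says that the curvature matrix is skew with respect to [g]. *)
Lemma skew_algebra {R : realType} {d : nat} (g c1 c2 P Q A B : 'M[R]_d) :
  c1 = P *m g + B *m (A *m g + g *m A^T) +
    ((A *m g + g *m A^T) *m B^T + g *m P^T) ->
  c2 = Q *m g + A *m (B *m g + g *m B^T) +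
    ((B *m g + g *m B^T) *m A^T + g *m Q^T) ->
  c1 = c2 ->
  (P - Q + B *m A - A *m B) *m g + g *m (P - Q + B *m A - A *m B)^T = 0.
Proof.
move=> E1 E2 E; have : c1 - c2 = 0 by rewrite E subrr.
have trB (M N : 'M[R]_d) : (M - N)^T = M^T - N^T by exact: linearB.
have trD (M N : 'M[R]_d) : (M + N)^T = M^T + N^T by exact: linearD.
rewrite {}E1 {}E2 trB trD trB !trmx_mul.
rewrite !mulmxDr !mulmxDl !mulmxN !mulNmx !mulmxA => H.
apply/matrixP => i j; move/matrixP/(_ i j): H; rewrite !mxE => H.
by rewrite -[RHS]H; ring.
Qed.

(** * Symmetries of the curvature tensor, up to invariance under J *)

Section Curvature.
Context {R : realType} {d : nat}.
Variables (D : set 'rV[R]_d) (G : 'rV[R]_d -> 'M[R]_d).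
Hypothesis oD : open D.
Hypothesis sG : smooth_on D G.
Hypothesis symG : forall y, D y -> (G y)^T = G y.
Hypothesis posG : forall y, D y -> forall v, v != 0 -> 0 < inner (G y) v v.
Implicit Types (y X Y Z W : 'rV[R]_d).

Let did : forall u, D u -> D (id u). Proof. by []. Qed.

Lemma curvatureE y X Y Z : D y -> curvature G y X Y Z = Z *m curv_mx G y X Y.
Proof.
move=> Dy; have sid := smooth_id D.
have sZ : smooth_on D (fun=> Z : 'rV[R]_d) by move=> k; exact: class_C_cst.
have := covD_commutator oD sG symG posG oD sid did X Y Dy sZ.
rewrite !derive_id => <-; rewrite /curvature.
have E V W : covderiv G id V (covderiv G id W (cst Z)) y =
    covD G id V (covD G id W (cst Z)) y.
  transitivity (covD G id V (covderiv G id W (cst Z)) y).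
    exact: (covderivE sG posG did).
  apply: (covD_ext _ _ oD _ Dy) => x Dx; exact: (covderivE sG posG did).
by rewrite !E.
Qed.

Lemma curvature_christoffel y X Y Z : curvature G y X Y Z =
  'D_X (fun x => christoffel G x Y Z) y + christoffel G y X (christoffel G y Y Z)
  - ('D_Y (fun x => christoffel G x X Z) y
     + christoffel G y Y (christoffel G y X Z)).
Proof.
have E V : covderiv G id V (cst Z) = fun x => christoffel G x V Z.
  by apply/funext => x; rewrite /covderiv derive_cst add0r derive_id.
by rewrite /curvature !E /covderiv !derive_id.
Qed.

Lemma curvature_antisym y X Y Z : curvature G y Y X Z = - curvature G y X Y Z.
Proof. by rewrite /curvature opprB. Qed.

Lemma curvature_bianchi y X Y Z : D y ->
  curvature G y X Y Z + curvature G y Y Z X + curvature G y Z X Y = 0.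
Proof.
move=> Dy; rewrite !curvature_christoffel.
have E V W V' : 'D_V (fun x => christoffel G x W V') y =
    'D_V (fun x => christoffel G x V' W) y.
  apply: near_eq_derive; apply: (filterS (P := D)); last exact: open_nbhs_nbhs.
  by move=> x Dx; exact: (christoffelC oD sG symG posG).
rewrite (E X Z Y) (E Y X Z) (E Z Y X).
rewrite (christoffelC oD sG symG posG Z Y Dy) (christoffelC oD sG symG posG X Z Dy).
rewrite (christoffelC oD sG symG posG Y X Dy).
move: ('D_X _ y) ('D_Y _ y) ('D_Z _ y) => a b c.
move: (christoffel G y X _) (christoffel G y Y _) (christoffel G y Z _) => p q r.
by apply/matrixP => i j; rewrite !mxE; ring.
Qed.

Lemma curvatureDX y X X' Y Z : D y -> curvature G y (X + X') Y Z =
  curvature G y X Y Z + curvature G y X' Y Z.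
Proof.
move=> Dy; rewrite !curvatureE // -mulmxDr; congr (_ *m _).
have cD v w : conn G y (v + w) = conn G y v + conn G y w.
  rewrite (conn_sum oD sG symG posG (v + w) Dy) (conn_sum oD sG symG posG v Dy).
  rewrite (conn_sum oD sG symG posG w Dy) -big_split; apply: eq_bigr => a _.
  by rewrite mxE scalerDl.
have dD b v w : 'D_(v + w) (conn G ^~ (delta_mx 0 b)) y =
    'D_v (conn G ^~ (delta_mx 0 b)) y + 'D_w (conn G ^~ (delta_mx 0 b)) y.
  apply: deriveDl; exact: smooth_on_differentiable (smooth_conn oD sG posG _) Dy.
rewrite /curv_mx (cD X X') mulmxDr mulmxDl !opprD !addrA.
have -> : \matrix_b (Y *m 'D_(X + X') (conn G ^~ (delta_mx 0 b)) y
      - (X + X') *m 'D_Y (conn G ^~ (delta_mx 0 b)) y) =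
    \matrix_b (Y *m 'D_X (conn G ^~ (delta_mx 0 b)) y
      - X *m 'D_Y (conn G ^~ (delta_mx 0 b)) y) +
    \matrix_b (Y *m 'D_X' (conn G ^~ (delta_mx 0 b)) y
      - X' *m 'D_Y (conn G ^~ (delta_mx 0 b)) y).
  apply/row_matrixP => b; rewrite linearD /= !rowK dD mulmxDr mulmxDl opprD.
  by rewrite addrACA.
move: (\matrix_b _) (\matrix_b _) => P Q.
move: (_ *m _) (_ *m _) (_ *m _) (_ *m _) => a b c e.
by apply/matrixP => i j; rewrite !mxE; ring.
Qed.

Lemma curvature_skew y X Y Z W : D y ->
  inner (G y) (curvature G y X Y Z) W = - inner (G y) Z (curvature G y X Y W).
Proof.
move=> Dy; pose B := curv_mx G y X Y.
have sid := smooth_id D.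
suff E : B *m G y + G y *m B^T = 0.
  rewrite !curvatureE // /inner trmx_mul !mulmxA -/B.
  have -> : Z *m B *m G y = - (Z *m G y *m B^T).
    apply/eqP; rewrite -addr_eq0 -!mulmxA -mulmxDr E mulmx0 //.
  by rewrite mulNmx mxE.
pose A V := pull_conn G id V.
have dGA V x : D x -> 'D_V G x = A V x *m G x + G x *m (A V x)^T.
  exact: (derive_metric_along oD sG symG posG sid did V).
have dA V : differentiable (A V) y.
  exact: smooth_on_differentiable (smooth_pull_conn oD sG symG posG oD sid did V) Dy.
have dG : differentiable G y := smooth_on_differentiable sG Dy.
have ddG V V' : 'D_V ('D_V' G) y =
    ('D_V (A V') y *m G y + A V' y *m (A V y *m G y + G y *m (A V y)^T)) +
    ((A V y *m G y + G y *m (A V y)^T) *m (A V' y)^T + G y *m ('D_V (A V') y)^T).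
  have -> : 'D_V ('D_V' G) y =
      'D_V ((fun x => A V' x *m G x) + (fun x => G x *m (A V' x)^T)) y.
    apply: near_eq_derive; apply: (filterS (P := D)); last exact: open_nbhs_nbhs.
    by move=> x; exact: dGA.
  have dAT := differentiable_trmx (dA V').
  rewrite deriveD; last 2 first.
  - exact: diff_derivable (differentiable_mulmx (dA V') dG).
  - exact: diff_derivable (differentiable_mulmx dG dAT).
  rewrite (derive_mulmx V (dA V') dG) (derive_mulmx V dG dAT).
  by rewrite (derive_trmx V (dA V')) (dGA V y Dy).
have BE : B = 'D_X (A Y) y - 'D_Y (A X) y + A Y y *m A X y - A X y *m A Y y.
  have := curv_mx_pull oD sG symG posG oD sid did X Y Dy.
  by rewrite !derive_id.
rewrite BE; exact: (@skew_algebra _ _ _ _ _ _ _ _ _ (ddG X Y) (ddG Y X)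
  (schwarz_mx X Y oD Dy (sG 2))).
Qed.

Variable J : 'M[R]_d.
Hypothesis JJ : J *m J = - 1%:M.
Hypothesis JG : forall y, D y -> forall v w,
  inner (G y) (v *m J) (w *m J) = inner (G y) v w.
Hypothesis closedG : forall y, D y -> forall X Y Z,
  'D_X (fun z => inner (G z) (Y *m J) Z) y
  + 'D_Y (fun z => inner (G z) (Z *m J) X) y
  + 'D_Z (fun z => inner (G z) (X *m J) Y) y = 0.

Lemma derive_inner_metric y v a b : D y ->
  'D_v (fun z => inner (G z) a b) y = inner ('D_v G y) a b.
Proof.
move=> Dy; have dG := smooth_on_differentiable sG Dy.
have da (p q : nat) (M : 'M[R]_(p, q)) : differentiable (fun _ : 'rV[R]_d => M) y.
  exact: differentiable_cst.
have daG := differentiable_mulmx (da _ _ a) dG.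
have daGb := differentiable_mulmx daG (da _ _ b^T).
rewrite [LHS](derive_entry v 0 0 daGb) (derive_mulmx v daG (da _ _ b^T)).
by rewrite (derive_mulmx v (da _ _ a) dG) !derive_cst mul0mx add0r mulmx0 addr0.
Qed.

(** This is ∇J = 0 where J is a constant matrix; it is the point at which closedness of the
    fundamental form is put to work. *)
Lemma christoffel_complex y v w : D y ->
  christoffel G y v (w *m J) = christoffel G y v w *m J.
Proof.
move=> Dy; have dG := smooth_on_differentiable sG Dy.
apply: (@chris_complex _ _ (G y) (fun v => 'D_v G y) (metric_unit posG Dy)
  (fun v => metric_derive_sym oD sG symG v Dy) (fun v w => deriveDl v w dG)
  (fun a v => deriveZdir a v dG) J JJ (JG Dy)).
- move=> z a b; rewrite -!derive_inner_metric //.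
  apply: near_eq_derive; apply: (filterS (P := D)); last exact: open_nbhs_nbhs.
  by move=> x Dx; exact: JG.
- by move=> a b z; rewrite -!derive_inner_metric //; exact: closedG.
Qed.

Lemma curvature_complex y X Y Z : D y ->
  curvature G y X Y (Z *m J) = curvature G y X Y Z *m J.
Proof.
move=> Dy; rewrite !curvature_christoffel !christoffel_complex //.
have E V W : 'D_V (fun x => christoffel G x W (Z *m J)) y =
    'D_V (fun x => christoffel G x W Z) y *m J.
  have dC : differentiable (fun x => christoffel G x W Z) y.
    exact: smooth_on_differentiable (smooth_christoffel oD sG posG W Z) Dy.
  have dJ : differentiable (fun _ : 'rV[R]_d => J) y by exact: differentiable_cst.
  transitivity ('D_V (fun x => christoffel G x W Z *m J) y).
    apply: near_eq_derive; apply: (filterS (P := D)); last exact: open_nbhs_nbhs.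
    by move=> x Dx; exact: christoffel_complex.
  by rewrite (derive_mulmx V dC dJ) derive_cst mulmx0 addr0.
have alg (a a' b b' p q : 'rV[R]_d) : a' = a *m J -> b' = b *m J ->
    a' + p *m J - (b' + q *m J) = (a + p - (b + q)) *m J.
  by move=> -> ->; rewrite -!mulmxDl -mulmxBl.
exact: (alg _ _ _ _ _ _ (E X Y) (E Y X)).
Qed.

End Curvature.

(** * Algebraic curvature tensors *)

Section KahlerTensor.
Context {K : realFieldType} {V : zmodType}.
Variables (J : V -> V) (T : V -> V -> V -> V -> K).
Hypothesis JD : forall x y, J (x + y) = J x + J y.
Hypothesis JJ : forall x, J (J x) = - x.
Hypothesis TD : forall x x' y z w, T (x + x') y z w = T x y z w + T x' y z w.
Hypothesis T12 : forall x y z w, T y x z w = - T x y z w.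
Hypothesis T34 : forall x y z w, T x y w z = - T x y z w.
Hypothesis TB : forall x y z w, T x y z w + T y z x w + T z x y w = 0.
Hypothesis TJ : forall x y z w, T x y (J z) (J w) = T x y z w.
Hypothesis TH : forall x, T x (J x) (J x) x = 0.

(** The octahedron argument: the Bianchi identities at the four cyclic rotations of the arguments
    combine, by skewness in each pair, into the symmetry between pairs. *)
Lemma tensor_pairC x y z w : T x y z w = T z w x y.
Proof.
have := TB x y z w; have := TB y z w x; have := TB z w x y; have := TB w x y z.
have := T34 x y z w; have := T34 z w x y; have := T34 y z x w.
have := T34 w x z y; have := T12 z x w y; have := T34 z x y w.
have := T12 w y x z; have := T34 w y z x; lra.
Qed.

Lemma tensor_D2 x y y' z w : T x (y + y') z w = T x y z w + T x y' z w.
Proof. by rewrite T12 TD opprD -!T12. Qed.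

Lemma tensor_D3 x y z z' w : T x y (z + z') w = T x y z w + T x y z' w.
Proof. by rewrite tensor_pairC TD !(tensor_pairC _ w). Qed.

Lemma tensor_D4 x y z w w' : T x y z (w + w') = T x y z w + T x y z w'.
Proof. by rewrite T34 tensor_D3 opprD -!T34. Qed.

Lemma tensor_N1 x y z w : T (- x) y z w = - T x y z w.
Proof.
have T0 : T 0 y z w = 0 by have := TD 0 0 y z w; rewrite addr0; lra.
by have := TD x (- x) y z w; rewrite subrr T0; lra.
Qed.

Lemma tensor_N2 x y z w : T x (- y) z w = - T x y z w.
Proof. by rewrite T12 tensor_N1 -T12. Qed.

Lemma tensor_N3 x y z w : T x y (- z) w = - T x y z w.
Proof. by rewrite tensor_pairC tensor_N1 -tensor_pairC. Qed.

Lemma tensor_N4 x y z w : T x y z (- w) = - T x y z w.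
Proof. by rewrite T34 tensor_N3 -T34. Qed.

(** Pair symmetry carries the invariance under J from the last two arguments to the first two. *)
Lemma tensor_J1 x y z w : T x (J y) z w = T y (J x) z w.
Proof.
rewrite tensor_pairC -TJ JJ -tensor_pairC tensor_N2 [RHS]T12.
by rewrite tensor_pairC.
Qed.

Lemma tensor_J2 x y z w : T x y z (J w) = T x y w (J z).
Proof. by rewrite tensor_pairC tensor_J1 -tensor_pairC. Qed.

(* The symmetrization of T(X, JY, Z, JW) vanishes on the diagonal; its value at
   (X, X, Y, Y) relates T(X, JX, Y, JY) to T(X, JY, X, JY). *)
Lemma tensor_holomorphic x y : T x (J x) y (J y) + 2 * T x (J y) x (J y) = 0.
Proof.
have q a : T a (J a) a (J a) = 0.
  by have := TH a; rewrite T34; lra.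
have JN a : J (- a) = - J a.
  have J0 : J 0 = 0.
    by apply: (addrI (J 0)); rewrite -JD !addr0.
  by apply: (addrI (J a)); rewrite -JD !subrr.
(* Adding the two expansions leaves only the terms of degree two in [x] and two in [y]. *)
have := q (x + y); have := q (x - y).
rewrite !JD !JN !TD !tensor_D2 !tensor_D3 !tensor_D4.
rewrite !(tensor_N1, tensor_N2, tensor_N3, tensor_N4) !q.
rewrite (tensor_J1 y x) (tensor_J2 x (J y) y x).
have := tensor_pairC y (J y) x (J x).
have := tensor_J1 y x x (J y); have := tensor_J2 x (J y) y x.
have := tensor_J1 y x y (J x).
lra.
Qed.

(** The Bianchi identity turns [tensor_holomorphic] into 3p + q = 0 for p = T(x, Jy, x, Jy) and q =
    T(x, y, x, y). Replacing y by Jy exchanges p and q, and the resulting system has determinant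
    8. *)
Lemma tensor_sectional x y : T x y x y = 0.
Proof.
have sec a b : 3 * T a (J b) a (J b) + T a b a b = 0.
  have := tensor_holomorphic a b; have := TB a (J a) b (J b).
  have := TJ b a a b; have := T12 b (J a) a (J b); have := tensor_J1 b a a (J b).
  have := T12 a b a b; have := T34 b a a b; lra.
have := sec x y; have := sec x (J y).
by rewrite JJ tensor_N2 tensor_N4; lra.
Qed.

(** Polarizing T(x, y, x, y) = 0 makes T skew in its first and third arguments as well; the three
    terms of the Bianchi identity are then equal. *)
Lemma tensor_eq0 x y z w : T x y z w = 0.
Proof.
have T1 a b e : T a b a e = 0.
  have := tensor_sectional a (b + e).
  rewrite tensor_D2 !tensor_D4 !tensor_sectional.
  have := tensor_pairC a e a b; lra.
have swap a b e f : T e b a f = - T a b e f.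
  by have := T1 (a + e) b f; rewrite TD !tensor_D3 !T1; lra.
have := TB x y z w; rewrite (T12 z y) (swap x y z) (swap y x z) (T12 x y).
lra.
Qed.

End KahlerTensor.

(* The curvature tensor of constant holomorphic curvature 4. *)
Definition space_form_tensor {K : realFieldType} {V : zmodType} (J : V -> V)
    (b : V -> V -> K) (x y z w : V) : K :=
  b y z * b x w - b x z * b y w + b (J y) z * b (J x) w
  - b (J x) z * b (J y) w - 2 * b (J x) y * b (J z) w.

(** The difference of the two sides satisfies the hypotheses of [tensor_eq0]. The model tensor takes
    the value 4 b(x, x)^2 at (x, Jx, Jx, x), which accounts for c/4. *)
Lemma space_form_unique {K : realFieldType} {V : zmodType} (J : V -> V)
    (b : V -> V -> K) (T : V -> V -> V -> V -> K) (c : K) :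
  (forall x y, J (x + y) = J x + J y) -> (forall x, J (J x) = - x) ->
  (forall x y z, b (x + y) z = b x z + b y z) -> (forall x y, b x y = b y x) ->
  (forall x y, b (J x) (J y) = b x y) ->
  (forall x x' y z w, T (x + x') y z w = T x y z w + T x' y z w) ->
  (forall x y z w, T y x z w = - T x y z w) ->
  (forall x y z w, T x y w z = - T x y z w) ->
  (forall x y z w, T x y z w + T y z x w + T z x y w = 0) ->
  (forall x y z w, T x y (J z) (J w) = T x y z w) ->
  (forall x, T x (J x) (J x) x = c * b x x ^+ 2) ->
  forall x y z w, T x y z w = c / 4 * space_form_tensor J b x y z w.
Proof.
move=> JD JJ bD bC bJ TD T12 T34 TB TJ TH x y z w.
have bN u v : b (- u) v = - b u v.
  have b0 : b 0 v = 0 by have := bD 0 0 v; rewrite addr0; lra.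
  by have := bD u (- u) v; rewrite subrr b0; lra.
have wJ u v : b (J u) (J v) = b u v by [].
have JJb u v : b (J (J u)) v = - b u v by rewrite JJ bN.
have wC u v : b (J v) u = - b (J u) v.
  by rewrite -bJ JJb bC.
have wr u v : b u (J v) = - b (J u) v by rewrite bC wC.
apply/eqP; rewrite -subr_eq0; apply/eqP.
apply: (@tensor_eq0 K V J
  (fun x y z w => T x y z w - c / 4 * space_form_tensor J b x y z w)) => //;
  rewrite /space_form_tensor.
- by move=> x1 x2 y1 z1 w1; rewrite TD JD !bD; ring.
- by move=> x1 y1 z1 w1; rewrite (T12 x1 y1) (wC x1 y1); ring.
- move=> x1 y1 z1 w1; rewrite (T34 x1 y1) (wC z1 w1); ring.
- move=> x1 y1 z1 w1; rewrite (wC z1 y1) (wC x1 z1) (wC x1 y1).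
  rewrite (bC z1 x1) (bC z1 y1) (bC y1 x1).
  have := TB x1 y1 z1 w1; set t := T _ _ _ _; set t' := T _ _ _ _.
  set t'' := T _ _ _ _ => E; rewrite -[RHS]E; ring.
- move=> x1 y1 z1 w1; rewrite TJ !wr !JJb; ring.
- move=> x1; rewrite TH !wr !JJb.
  have b0 : b (J x1) x1 = 0 by have := wC x1 x1; lra.
  by rewrite b0; field.
Qed.

(** * Linear algebra behind the two implications *)

Section MatrixAlgebra.
Context {K : realFieldType} {n : nat}.
Hypothesis n2 : (2 <= n)%N.

Lemma exists_other (i : 'I_n) : exists j : 'I_n, j != i.
Proof.
have [->|] := eqVneq i (Ordinal (ltnW n2)); last first.
  by exists (Ordinal (ltnW n2)); rewrite eq_sym.
by exists (Ordinal n2).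
Qed.

(** For Z = e_j with j different from i, entry (j, i) of the relation reads k_i = 0; such a j exists
    because n >= 2. *)
Lemma swap_rank1_eq0 (k : 'cV[K]_n) :
  (forall Z : 'rV[K]_n, Z^T *m k^T = k *m Z) -> k = 0.
Proof.
move=> kZ; apply/colP => i; have [j ji] := exists_other i.
have /matrixP/(_ j i) := kZ (delta_mx 0 j).
rewrite trmx_delta !mxE (bigD1 0) //= big1 ?addr0; last first.
  by move=> a; rewrite (ord1 a) eqxx.
rewrite !mxE !eqxx mul1r => ->.
rewrite (bigD1 0) //= big1 ?addr0; last by move=> a; rewrite (ord1 a) eqxx.
by rewrite !mxE eqxx (eq_sym i) (negbTE ji) mulr0.
Qed.

(* The matrices E_ij - E_ji span so(n). *)
Lemma so_commutant_scalar (A : 'M[K]_n) :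
  (forall i j, A^T *m (delta_mx i j - delta_mx j i)
               = (delta_mx i j - delta_mx j i) *m A) ->
  exists l, A = l%:M.
Proof.
move=> AE.
have mulA i j k l : (A^T *m delta_mx i j) k l = A i k * (l == j)%:R.
  rewrite mxE (bigD1 i) //= big1 ?addr0 => [|a ai].
    by rewrite !mxE eqxx.
  by rewrite !mxE (negbTE ai) mulr0.
have mulAr i j k l : (delta_mx i j *m A) k l = (k == i)%:R * A j l.
  rewrite mxE (bigD1 j) //= big1 ?addr0 => [|a aj].
    by rewrite !mxE eqxx andbT.
  by rewrite !mxE (negbTE aj) andbF mul0r.
have E i j k l : A i k * (l == j)%:R - A j k * (l == i)%:R =
    (k == i)%:R * A j l - (k == j)%:R * A i l.
  have /matrixP/(_ k l) := AE i j; rewrite mulmxBr mulmxBl.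
  have subE (M N : 'M[K]_n) : (M - N) k l = M k l - N k l by rewrite !mxE.
  by rewrite !subE !mulA !mulAr.
exists (A (Ordinal (ltnW n2)) (Ordinal (ltnW n2))).
(* For E_ij - E_ji, entry (i, i) of the relation gives 2 A_ji = 0 and entry (i, j) gives A_ii =
   A_jj. *)
have off i j : i != j -> A j i = 0.
  move=> ij; have := E i j i i.
  by rewrite !eqxx (negbTE ij) mulr0 mul0r mulr1 mul1r; lra.
have diag i j : i != j -> A i i = A j j.
  move=> ij; have := E i j i j.
  rewrite !eqxx (negbTE ij) (eq_sym j) (negbTE ij) !mulr0 !mul0r mulr1 mul1r; lra.
apply/matrixP => i j; rewrite mxE; have [->|ij] := eqVneq i j.
  rewrite mulr1n; have [->//|] := eqVneq j (Ordinal (ltnW n2)); exact: diag.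
by rewrite mulr0n off // eq_sym.
Qed.

Variables (g : 'M[K]_n) (c : K).
Hypothesis ug : g \in unitmx.
Hypothesis c0 : c != 0.

(* [s] and [b] are the second fundamental form of xi and the covector
   X |-> <JX, xi>; [sJ Z] is the second fundamental form of JZ. *)
Variables (s : 'M[K]_n) (b : 'cV[K]_n) (sJ : 'rV[K]_n -> 'M[K]_n).
Hypothesis sT : s^T = s.
Hypothesis gT : g^T = g.
Hypothesis ricci_J : forall Z, s *m invmx g *m sJ Z - sJ Z *m invmx g *m s =
  c *: (g *m Z^T *m b^T - b *m (g *m Z^T)^T).
Hypothesis ricci_JJ : forall Z W,
  sJ Z *m invmx g *m sJ W - sJ W *m invmx g *m sJ Z =
  c *: (g *m W^T *m (g *m Z^T)^T - g *m Z^T *m (g *m W^T)^T).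

Lemma scalar_shape_eq0 l : s *m invmx g = l%:M -> b = 0.
Proof.
move=> sl; have sE : s = l *: g by rewrite -[s](mulmxKV ug) sl mul_scalar_mx.
(* Raising the index: for the tangent vector dual to the covector [b], the metric disappears from
   the relation. *)
suff k0 : invmx g *m b = 0 by rewrite -[b](mulKVmx ug) k0 mulmx0.
apply: swap_rank1_eq0 => Z; have := ricci_J Z.
rewrite sl {1}sE -scalemxAr mulmxKV // mul_scalar_mx subrr => /esym/eqP.
rewrite scaler_eq0 (negbTE c0) /= subr_eq0 => /eqP.
rewrite trmx_mul trmxK gT => E.
rewrite trmx_mul trmx_inv gT.
have := congr1 (fun M => invmx g *m M *m invmx g) E.
by rewrite !mulmxA mulVmx // mul1mx mulmxK.
Qed.

Lemma scalar_shape : b = 0 -> exists l, s *m invmx g = l%:M.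
Proof.
move=> b0; pose A := s *m invmx g; pose AJ Z := sJ Z *m invmx g.
have comm Z : A *m AJ Z = AJ Z *m A.
  have := ricci_J Z; rewrite b0 trmx0 mulmx0 mul0mx subrr scaler0.
  by move=> /subr0_eq E; rewrite /A /AJ !mulmxA E.
(* Self-adjointness of [A] for [g]. It turns commutation of [A] with g K, for K skew, into A^T K = K
   A, where the metric no longer appears. *)
have gA : g *m A^T = A *m g.
  by rewrite /A trmx_mul sT trmx_inv gT mulmxA mulmxV // mul1mx mulmxKV.
apply: so_commutant_scalar => i j.
pose Z : 'rV[K]_n := delta_mx 0 j; pose W : 'rV[K]_n := delta_mx 0 i.
have -> : delta_mx i j - delta_mx j i = W^T *m Z - Z^T *m W.
  by rewrite !trmx_delta !mul_delta_mx.
have br : AJ Z *m AJ W - AJ W *m AJ Z = c *: (g *m (W^T *m Z - Z^T *m W)).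
  have := congr1 (mulmx^~ (invmx g)) (ricci_JJ Z W).
  rewrite mulmxBl /AJ !mulmxA => ->.
  rewrite -scalemxAl !trmx_mul !trmxK gT !mulmxBl mulmxBr !mulmxA.
  by rewrite !mulmxK.
have : A *m (AJ Z *m AJ W - AJ W *m AJ Z) = (AJ Z *m AJ W - AJ W *m AJ Z) *m A.
  have comm2 Z1 W1 : A *m (AJ Z1 *m AJ W1) = AJ Z1 *m AJ W1 *m A.
    by rewrite mulmxA (comm Z1) -mulmxA (comm W1) mulmxA.
  by rewrite mulmxBr mulmxBl (comm2 Z W) (comm2 W Z).
rewrite br -scalemxAr -scalemxAl => /(scalerI c0).
rewrite mulmxA -gA -!mulmxA => /(congr1 (mulmx (invmx g))).
by rewrite !mulmxA mulVmx // !mul1mx.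
Qed.

End MatrixAlgebra.

(** * The Ricci equation *)

Section Ricci.
Context {R : realType} {d n : nat}.
Variables (D : set 'rV[R]_d) (G : 'rV[R]_d -> 'M[R]_d).
Hypothesis oD : open D.
Hypothesis sG : smooth_on D G.
Hypothesis symG : forall y, D y -> (G y)^T = G y.
Hypothesis posG : forall y, D y -> forall v, v != 0 -> 0 < inner (G y) v v.
Variables (U : set 'rV[R]_n) (f : 'rV[R]_n -> 'rV[R]_d).
Hypothesis oU : open U.
Hypothesis sf : smooth_on U f.
Hypothesis fUD : forall u, U u -> D (f u).
Hypothesis rf : forall u, U u -> row_free ('J f u).
Implicit Types (u v X Y : 'rV[R]_n) (w eta : 'rV[R]_d).

Let df u : U u -> differentiable f u.
Proof. exact: smooth_on_differentiable. Qed.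

Let nbhsU u : U u -> nbhs u U.
Proof. by move=> Uu; exact: open_nbhs_nbhs. Qed.

Definition normal_at u w : Prop := w *m G (f u) *m ('J f u)^T = 0.

Lemma normal_spaceP u w : normal_space_at G f u w <-> normal_at u w.
Proof.
rewrite /normal_at; split=> [H|H t [X _ <-]].
  apply/rowP => j; rewrite [RHS]mxE.
  have := H _ (ex_intro2 _ _ (delta_mx 0 j) I erefl).
  by rewrite /inner trmx_mul trmx_delta mulmxA -colE mxE.
by rewrite /inner trmx_mul mulmxA H mul0mx mxE.
Qed.

Lemma row_jacobian u b : U u -> row b ('J f u) = 'D_(delta_mx 0 b) f u.
Proof. by move=> Uu; rewrite (deriveEjacobian _ (df Uu)) rowE. Qed.

Lemma smooth_jacobian : smooth_on U (fun u => 'J f u).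
Proof.
move=> k; apply/class_C_mxP => // b j.
have := (class_C_mxP _ _ oU).1 (smooth_on_derive (delta_mx 0 b) sf k) 0 j.
by apply: class_C_ext => // u Uu; rewrite -row_jacobian // mxE.
Qed.

Let sJ := smooth_jacobian.

Let sGf : smooth_on U (fun u => G (f u)).
Proof. by move=> k; exact: (class_C_comp_mx oU oD fUD (sf k) (sG k)). Qed.

Lemma induced_metric_sym u : U u -> (induced_metric G f u)^T = induced_metric G f u.
Proof.
by move=> Uu; rewrite /induced_metric !trmx_mul trmxK symG ?mulmxA //; exact: fUD.
Qed.

Lemma induced_metric_unit u : U u -> induced_metric G f u \in unitmx.
Proof.
move=> Uu; apply: pos_unitmx => v v0.
have -> : inner (induced_metric G f u) v v =
    inner (G (f u)) (v *m 'J f u) (v *m 'J f u).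
  by rewrite /inner /induced_metric trmx_mul !mulmxA.
apply: (posG (fUD Uu)); apply: contraNneq v0 => vJ.
by apply/eqP; apply: (row_free_inj (rf Uu)); rewrite vJ mul0mx.
Qed.

Lemma smooth_induced_inv : smooth_on U (fun u => invmx (induced_metric G f u)).
Proof.
move=> k; apply: class_C_invmx => //; first exact: induced_metric_unit.
apply: class_C_mulmx => //; last by apply: class_C_trmx => //; exact: sJ.
exact: class_C_mulmx.
Qed.

Definition tangent_coef u w : 'rV[R]_n :=
  w *m G (f u) *m ('J f u)^T *m invmx (induced_metric G f u).

Lemma tangent_partE u w : tangent_part G f u w = tangent_coef u w *m 'J f u.
Proof. by []. Qed.

Lemma smooth_tangent_coef (xi : 'rV[R]_n -> 'rV[R]_d) : smooth_on U xi ->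
  smooth_on U (fun u => tangent_coef u (xi u)).
Proof.
move=> sxi k; apply: class_C_mulmx => //; last exact: smooth_induced_inv.
apply: class_C_mulmx => //; last by apply: class_C_trmx => //; exact: sJ.
by apply: class_C_mulmx => //; exact: sGf.
Qed.

Lemma smooth_normal_part (xi : 'rV[R]_n -> 'rV[R]_d) : smooth_on U xi ->
  smooth_on U (fun u => normal_part G f u (xi u)).
Proof.
move=> sxi k; apply: class_CB => //.
by apply: class_C_mulmx => //; exact: smooth_tangent_coef.
Qed.

Lemma normal_part_normal u w : U u -> normal_at u (normal_part G f u w).
Proof.
move=> Uu; rewrite /normal_at /normal_part tangent_partE !mulmxBl.
have -> : tangent_coef u w *m 'J f u *m G (f u) *m ('J f u)^T =
    tangent_coef u w *m induced_metric G f u by rewrite /induced_metric !mulmxA.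
by rewrite /tangent_coef mulmxKV ?subrr //; exact: induced_metric_unit.
Qed.

Lemma normal_part_id u w : normal_at u w -> normal_part G f u w = w.
Proof.
by move=> nw; rewrite /normal_part /tangent_part nw !mul0mx subr0.
Qed.

Lemma inner_normal_r u a eta : U u -> normal_at u eta ->
  inner (G (f u)) (a *m 'J f u) eta = 0.
Proof.
move=> Uu ne; rewrite (innerC _ _ (symG (fUD Uu))) /inner trmx_mul mulmxA.
by rewrite ne mul0mx mxE.
Qed.

Lemma inner_normal_part u w eta : U u -> normal_at u eta ->
  inner (G (f u)) (normal_part G f u w) eta = inner (G (f u)) w eta.
Proof.
move=> Uu ne; rewrite /normal_part innerDl innerNl tangent_partE.
by rewrite inner_normal_r // subr0.
Qed.

Definition shape_mx u eta : 'M[R]_n := \matrix_(a, b)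
  inner (G (f u)) (second_form G f u (delta_mx 0 a) (delta_mx 0 b)) eta.

Lemma shape_mxE u eta a b : U u -> normal_at u eta -> shape_mx u eta a b =
  inner (G (f u)) (covderiv G f (delta_mx 0 a) ('D_(delta_mx 0 b) f) u) eta.
Proof. by move=> Uu ne; rewrite mxE inner_normal_part. Qed.

(** Symmetry of the second fundamental form: second derivatives of [f] commute and the connection
    has no torsion. *)
Lemma shape_mx_sym u eta : U u -> normal_at u eta ->
  (shape_mx u eta)^T = shape_mx u eta.
Proof.
move=> Uu ne; apply/matrixP => a b; rewrite mxE.
have E : covderiv G f (delta_mx 0 b) ('D_(delta_mx 0 a) f) u =
    covderiv G f (delta_mx 0 a) ('D_(delta_mx 0 b) f) u.
  exact: (congr2 +%R (schwarz_mx _ _ oU Uu (sf 2))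
    (christoffelC oD sG symG posG _ _ (fUD Uu))).
exact: (etrans (shape_mxE b a Uu ne) (etrans (congr1 (fun z => inner _ z eta) E)
  (esym (shape_mxE a b Uu ne)))).
Qed.

Lemma row_covD_jacobian X u b : U u ->
  row b (covD G f X (fun x => 'J f x) u) = covderiv G f X ('D_(delta_mx 0 b) f) u.
Proof.
move=> Uu; rewrite (covderivE sG posG fUD) // /covD linearD /= row_mul.
rewrite row_jacobian //; congr (_ + _).
have dJ := smooth_on_differentiable sJ Uu.
rewrite -(derive_row X b dJ).
apply: near_eq_derive; apply: filterS (nbhsU Uu) => x Ux.
exact: row_jacobian.
Qed.

(** Makes the linearity in [X] explicit, so that the entries of [shape_mx], defined on basis
    vectors, determine the second fundamental form in every direction. *)
Lemma covderiv_tangent X u b : U u -> covderiv G f X ('D_(delta_mx 0 b) f) u =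
  X *m ('J ('D_(delta_mx 0 b) f) u
        + 'J f u *m conn G (f u) ('D_(delta_mx 0 b) f u)).
Proof.
move=> Uu; rewrite mulmxDr mulmxA.
have dfb := smooth_on_differentiable (smooth_on_derive (delta_mx 0 b) sf) Uu.
have E := etrans (christoffelC oD sG symG posG _ _ (fUD Uu))
  (etrans (christoffelE sG posG ('D_(delta_mx 0 b) f u) ('D_X f u) (fUD Uu))
    (congr1 (mulmx^~ _) (deriveEjacobian X (df Uu)))).
exact: (congr2 +%R (deriveEjacobian X dfb) E).
Qed.

(** Gauss' formula paired with a normal vector, for all coordinate fields at once. *)
Lemma covD_jacobian_normal X u eta : U u -> normal_at u eta ->
  covD G f X (fun x => 'J f x) u *m G (f u) *m eta^T = (X *m shape_mx u eta)^T.
Proof.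
move=> Uu ne; apply/colP => b; rewrite [RHS]mxE [RHS]mxE.
transitivity (inner (G (f u)) (covderiv G f X ('D_(delta_mx 0 b) f) u) eta).
  have E (M : 'cV[R]_n) : M b 0 = row b M 0 0 by rewrite mxE.
  by rewrite E !row_mul (row_covD_jacobian X b Uu).
rewrite covderiv_tangent // /inner -!mulmxA mxE; apply: eq_bigr => a _.
congr (_ * _); rewrite shape_mxE // covderiv_tangent // /inner.
have E (L : 'M[R]_(n, d)) (w : 'cV[R]_d) :
    (L *m w) a 0 = ((delta_mx 0 a : 'rV[R]_n) *m L *m w) 0 0.
  by rewrite -rowE -row_mul [RHS]mxE.
by rewrite E !mulmxA.
Qed.

Variable xi : 'rV[R]_n -> 'rV[R]_d.
Hypothesis sxi : smooth_on U xi.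
Hypothesis nxi : forall u, U u -> normal_at u (xi u).

(** Weingarten's formula: differentiate along [Y] the orthogonality of [xi] to the rows of the
    Jacobian. *)
Lemma tangent_coef_covD Y u : U u -> tangent_coef u (covD G f Y xi u) =
  - (Y *m shape_mx u (xi u) *m invmx (induced_metric G f u)).
Proof.
move=> Uu; rewrite /tangent_coef -mulNmx; congr (_ *m _).
have dxi := smooth_on_differentiable sxi Uu.
have dJ := smooth_on_differentiable sJ Uu.
have := covD_compat oD sG symG posG sf fUD Y Uu dxi dJ.
have -> : 'D_Y (fun x => xi x *m G (f x) *m ('J f x)^T) u = 0.
  transitivity ('D_Y (cst (0 : 'rV[R]_n)) u); last exact: derive_cst.
  by apply: near_eq_derive; apply: filterS (nbhsU Uu) => x; exact: nxi.
have -> : xi u *m G (f u) *m (covD G f Y (fun x => 'J f x) u)^T =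
    Y *m shape_mx u (xi u).
  rewrite -[RHS]trmxK -covD_jacobian_normal //; last exact: nxi.
  by rewrite !trmx_mul trmxK symG ?mulmxA //; exact: fUD.
by move=> /esym/eqP; rewrite addr_eq0 => /eqP.
Qed.

(** Projecting before the second derivative removes a tangent field a 'J f. Its derivative has a
    tangent term, killed by [eta], and a term in the derivative of the Jacobian; by Weingarten and
    Gauss the latter is the product of the two shape matrices. *)
Lemma inner_covD_normal_covderiv X Y u eta : U u -> normal_at u eta ->
  inner (G (f u)) (normal_covderiv G f X (normal_covderiv G f Y xi) u) eta =
  inner (G (f u)) (covD G f X (covD G f Y xi) u) eta
  + (Y *m shape_mx u (xi u) *m invmx (induced_metric G f u)
      *m shape_mx u eta *m X^T) 0 0.
Proof.
move=> Uu ne; rewrite inner_normal_part //.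
pose phi := covD G f Y xi; pose a x := tangent_coef x (phi x).
have sphi : smooth_on U phi := smooth_covD oD sG symG posG oU sf fUD Y sxi.
have sa : smooth_on U a := smooth_tangent_coef sphi.
have dphi := smooth_on_differentiable sphi Uu.
have da := smooth_on_differentiable sa Uu.
have dJ := smooth_on_differentiable sJ Uu.
have daJ := differentiable_mulmx da dJ.
have -> : covderiv G f X (normal_covderiv G f Y xi) u =
    covD G f X phi u - ('D_X a u *m 'J f u + a u *m covD G f X (fun x => 'J f x) u).
  transitivity (covD G f X (fun x => phi x - a x *m 'J f x) u).
    transitivity (covD G f X (normal_covderiv G f Y xi) u).
      exact: (covderivE sG posG fUD).
    apply: (covD_ext _ _ oU _ Uu) => x Ux.
    exact: (congr1 (normal_part G f x) (covderivE sG posG fUD Y xi Ux)).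
  rewrite {1 3}/covD.
  have -> : 'D_X (fun x => phi x - a x *m 'J f x) u =
      'D_X phi u - ('D_X a u *m 'J f u + a u *m 'D_X (fun x => 'J f x) u).
    rewrite -(derive_mulmx X da dJ).
    exact: (deriveB (diff_derivable dphi) (diff_derivable daJ)).
  rewrite mulmxBl mulmxDr !mulmxA !opprD !addrA; congr (_ - _).
  by rewrite addrAC; congr (_ - _); rewrite addrAC.
have alg (p q r : 'rV[R]_d) : inner (G (f u)) (p - (q + r)) eta =
    inner (G (f u)) p eta - (inner (G (f u)) q eta + inner (G (f u)) r eta).
  by rewrite innerDl innerNl innerDl.
rewrite alg inner_normal_r // add0r.
have -> : inner (G (f u)) (a u *m covD G f X (fun x => 'J f x) u) eta =
  - (Y *m shape_mx u (xi u) *m invmx (induced_metric G f u)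
      *m shape_mx u eta *m X^T) 0 0; last by rewrite opprK.
have -> : a u = - (Y *m shape_mx u (xi u) *m invmx (induced_metric G f u)).
  exact: tangent_coef_covD.
rewrite mulNmx innerNl /inner -!mulmxA.
have -> : covD G f X (fun x => 'J f x) u *m (G (f u) *m eta^T) =
    (X *m shape_mx u eta)^T by rewrite mulmxA covD_jacobian_normal.
by rewrite trmx_mul shape_mx_sym.
Qed.

Lemma ricci X Y u eta : U u -> normal_at u eta ->
  normal_curvature G f X Y xi u = 0 ->
  inner (G (f u)) (curvature G (f u) (X *m 'J f u) (Y *m 'J f u) (xi u)) eta =
  (X *m shape_mx u (xi u) *m invmx (induced_metric G f u)
     *m shape_mx u eta *m Y^T) 0 0
  - (Y *m shape_mx u (xi u) *m invmx (induced_metric G f u)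
     *m shape_mx u eta *m X^T) 0 0.
Proof.
move=> Uu ne flat.
have alg (a1 a2 : 'rV[R]_d) (p q r s : R) : inner (G (f u)) a1 eta = p + r ->
    inner (G (f u)) a2 eta = q + s -> a1 - a2 = 0 -> p - q = s - r.
  by move=> E1 E2 /subr0_eq E; move: E1; rewrite E E2; lra.
have HX := inner_covD_normal_covderiv X Y Uu ne.
have HY := inner_covD_normal_covderiv Y X Uu ne.
have alg2 (a1 a2 : 'rV[R]_d) : inner (G (f u)) (a1 - a2) eta =
    inner (G (f u)) a1 eta - inner (G (f u)) a2 eta.
  by rewrite innerDl innerNl.
have C : curvature G (f u) (X *m 'J f u) (Y *m 'J f u) (xi u) =
    covD G f X (covD G f Y xi) u - covD G f Y (covD G f X xi) u.
  apply: etrans (esym (covD_commutator oD sG symG posG oU sf fUD X Y Uu sxi)).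
  have E V : V *m 'J f u = 'D_V f u by rewrite (deriveEjacobian _ (df Uu)).
  by rewrite (E X) (E Y); exact: (curvatureE oD sG symG posG _ _ _ (fUD Uu)).
rewrite C; exact: (etrans (alg2 _ _) (alg _ _ _ _ _ _ HX HY flat)).
Qed.

End Ricci.

(** * Umbilical normal vectors *)

Section LocalTheorem.
Context {R : realType} {d n : nat}.
Variables (D : set 'rV[R]_d) (G : 'rV[R]_d -> 'M[R]_d) (J : 'M[R]_d) (c : R).
Hypothesis oD : open D.
Hypothesis sG : smooth_on D G.
Hypothesis symG : forall y, D y -> (G y)^T = G y.
Hypothesis posG : forall y, D y -> forall v, v != 0 -> 0 < inner (G y) v v.
Hypothesis JJ : J *m J = - 1%:M.
Hypothesis JG : forall y, D y -> forall v w,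
  inner (G y) (v *m J) (w *m J) = inner (G y) v w.
Hypothesis closedG : forall y, D y -> forall X Y Z : 'rV[R]_d,
  'D_X (fun z => inner (G z) (Y *m J) Z) y
  + 'D_Y (fun z => inner (G z) (Z *m J) X) y
  + 'D_Z (fun z => inner (G z) (X *m J) Y) y = 0.
Hypothesis holG : forall y, D y -> forall X : 'rV[R]_d, X != 0 ->
  sectional_curvature G y X (X *m J) = c.

Lemma curvature_space_form y (X Y Z W : 'rV[R]_d) : D y ->
  inner (G y) (curvature G y X Y Z) W =
  c / 4 * space_form_tensor (fun v => v *m J) (inner (G y)) X Y Z W.
Proof.
move=> Dy; have gC v w := innerC v w (symG Dy).
have JJv (v : 'rV[R]_d) : v *m J *m J = - v by rewrite -mulmxA JJ mulmxN mulmx1.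
apply: (@space_form_unique R 'rV[R]_d (fun v => v *m J) (inner (G y))
  (fun X Y Z W => inner (G y) (curvature G y X Y Z) W) c) => //.
- by move=> v w; rewrite mulmxDl.
- by move=> v w z; rewrite innerDl.
- exact: JG.
- move=> v v' w z t; rewrite -innerDl; congr (inner _ _ _).
  exact: (curvatureDX oD sG symG posG).
- by move=> v w z t; rewrite curvature_antisym innerNl.
- move=> v w z t.
  exact: (etrans (curvature_skew oD sG symG posG v w t z Dy)
    (congr1 -%R (gC _ _))).
- move=> v w z t; rewrite -!innerDl.
  by rewrite (curvature_bianchi oD sG symG posG v w z Dy) inner0l.
- move=> v w z t; rewrite (curvature_complex oD sG symG posG JJ JG closedG) //.
  exact: JG.
(* The sectional curvature is constrained only for nonzero [v]; at zero both sides vanish. Otherwise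
   [v] and Jv are orthogonal of equal length, so the denominator is the square of the squared length
   of [v]. *)
- move=> v; have [->|v0] := eqVneq v 0.
    by rewrite !inner0r expr0n mulr0.
  have E := holG Dy v0.
  have vJ : inner (G y) v (v *m J) = 0.
    have := JG Dy v (v *m J); rewrite JJv innerNr gC => H; lra.
  move: E; rewrite /sectional_curvature JG // vJ expr0n subr0 => <-.
  rewrite expr2 mulfVK // mulf_neq0 // gt_eqF //; exact: posG.
Qed.

Variables (U : set 'rV[R]_n) (f : 'rV[R]_n -> 'rV[R]_d) (u : 'rV[R]_n).
Hypothesis n2 : (2 <= n)%N.
Hypothesis c0 : c != 0.
Hypothesis oU : open U.
Hypothesis sf : smooth_on U f.
Hypothesis fUD : forall x, U x -> D (f x).
Hypothesis rf : forall x, U x -> row_free ('J f x).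
Hypothesis Uu : U u.
Hypothesis flat : forall xi : 'rV[R]_n -> 'rV[R]_d, smooth_on U xi ->
  (forall x, U x -> normal_at G f x (xi x)) ->
  forall X Y, normal_curvature G f X Y xi u = 0.
Hypothesis treal : forall Z : 'rV[R]_n, normal_at G f u (Z *m 'J f u *m J).
Implicit Types (xi eta : 'rV[R]_d) (X Y Z W : 'rV[R]_n).

Let g := induced_metric G f u.
Let S := shape_mx G f u.

(* The components of the covector X |-> <J X, eta>. *)
Let beta eta : 'cV[R]_n := 'J f u *m J *m G (f u) *m eta^T.

Let Gu := symG (fUD Uu).

Lemma betaE X eta : (X *m beta eta) 0 0 = inner (G (f u)) (X *m 'J f u *m J) eta.
Proof. by rewrite /beta /inner !mulmxA. Qed.

(** J is an isometry, so the covector <JX, JZ> of X is <X, Z>. This produces the terms g Z^T in the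
    hypotheses of the linear algebra. *)
Lemma beta_JZ Z : beta (Z *m 'J f u *m J) = g *m Z^T.
Proof.
have JGJ : J *m G (f u) *m J^T = G (f u).
  apply: inner_matrixP => v w; rewrite -(JG (fUD Uu)).
  by rewrite /inner trmx_mul !mulmxA.
rewrite /beta /g /induced_metric -{2}JGJ !trmx_mul !mulmxA //.
Qed.

Lemma flat_ricci xi eta : normal_at G f u xi -> normal_at G f u eta ->
  S xi *m invmx g *m S eta - S eta *m invmx g *m S xi =
  (c / 4) *: (beta eta *m (beta xi)^T - beta xi *m (beta eta)^T).
Proof.
move=> nxi neta; pose M := S xi *m invmx g *m S eta.
(* All factors are symmetric, so the commutator is M - M^T and its value on (X, Y) is the right side
   of the Ricci equation. *)
have MT : S eta *m invmx g *m S xi = M^T.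
  rewrite /M !trmx_mul trmx_inv (induced_metric_sym symG fUD Uu).
  by rewrite !(shape_mx_sym oD sG symG posG oU sf fUD Uu) // mulmxA.
rewrite MT; apply: inner_matrixP => X Y.
pose fld x := normal_part G f x xi.
have sfld : smooth_on U fld.
  apply: (smooth_normal_part oD sG posG oU sf fUD rf (xi := fun=> xi)).
  by move=> k; exact: class_C_cst.
have nfld x : U x -> normal_at G f x (fld x).
  by move=> Ux; exact: (normal_part_normal posG fUD rf).
have fldu : fld u = xi by exact: normal_part_id.
have := ricci oD sG symG posG oU sf fUD rf sfld nfld Uu neta (flat sfld nfld X Y).
rewrite fldu curvature_space_form; last exact: fUD.
have tn V zeta : normal_at G f u zeta -> inner (G (f u)) (V *m 'J f u) zeta = 0.
  exact: (inner_normal_r symG fUD).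
(* The submanifold is totally real: this removes the last term of the model tensor, while normality
   of [xi] and [eta] removes the first two. *)
have JXY : inner (G (f u)) (X *m 'J f u *m J) (Y *m 'J f u) = 0.
  by rewrite (innerC _ _ Gu) tn.
rewrite /space_form_tensor !tn // JXY -!betaE.
have -> : inner (M - M^T) X Y = inner M X Y - inner M Y X.
  by rewrite innerDm innerNm inner_trmx.
have bb e1 e2 : inner (beta e1 *m (beta e2)^T) X Y =
    (X *m beta e1) 0 0 * (Y *m beta e2) 0 0.
  rewrite /inner -mulmxA -mulmxA mulmxA mxE big_ord1.
  by rewrite -trmx_mul [in X in _ * X]mxE.
have -> : inner ((c / 4) *: (beta eta *m (beta xi)^T - beta xi *m (beta eta)^T)) X Y
   = c / 4 * (inner (beta eta *m (beta xi)^T) X Y - inner (beta xi *m (beta eta)^T) X Y).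
  by rewrite innerZm innerDm innerNm.
rewrite !bb.
have -> : inner M X Y = (X *m S xi *m invmx g *m S eta *m Y^T) 0 0.
  by rewrite /inner /M !mulmxA.
have -> : inner M Y X = (Y *m S xi *m invmx g *m S eta *m X^T) 0 0.
  by rewrite /inner /M !mulmxA.
move=> <-; ring.
Qed.

Lemma umbilical_iff_beta xi : normal_at G f u xi ->
  umbilical G f u xi <-> beta xi = 0.
Proof.
move=> nxi.
have ug : g \in unitmx := induced_metric_unit posG fUD rf Uu.
have gT : g^T = g := induced_metric_sym symG fUD Uu.
have sT : (S xi)^T = S xi := shape_mx_sym oD sG symG posG oU sf fUD Uu nxi.
have c40 : c / 4 != 0 by rewrite mulf_neq0 // invr_eq0.
pose SJ Z := S (Z *m 'J f u *m J).
have rJ Z : S xi *m invmx g *m SJ Z - SJ Z *m invmx g *m S xi =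
    (c / 4) *: (g *m Z^T *m (beta xi)^T - beta xi *m (g *m Z^T)^T).
  by rewrite -beta_JZ; exact: flat_ricci.
have rJJ Z W : SJ Z *m invmx g *m SJ W - SJ W *m invmx g *m SJ Z =
    (c / 4) *: (g *m W^T *m (g *m Z^T)^T - g *m Z^T *m (g *m W^T)^T).
  by rewrite -!beta_JZ; exact: flat_ricci.
split=> [[l Hl]|b0].
  exact: (scalar_shape_eq0 n2 ug c40 gT rJ Hl).
exact: (scalar_shape n2 ug c40 sT gT rJ rJJ b0).
Qed.

End LocalTheorem.

Lemma cplxJ_sq (R : realType) (m : nat) : cplxJ R m *m cplxJ R m = - 1%:M.
Proof.
rewrite /cplxJ mulmx_block !mulmx0 !mul0mx !mulmx1 !mul1mx !addr0 !add0r.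
by rewrite [in RHS]scalar_mx_block opp_block_mx !oppr0.
Qed.

(** * Coordinate domains of the immersion *)

Section LocalCharts.
Variables (R : realType) (n m : nat).
Variables (M : smoothManifold R n) (N : kahlerManifold R m) (F : M -> N).
Variables (i : chart_index M) (k : chart_index N).

Lemma local_rep_image u : local_dom F i k u ->
  (chart k @` chart_dom k) (local_rep F i k u).
Proof.
move=> [x [xi Fxk] <-]; exists (F x) => //.
by rewrite /local_rep /= chartK.
Qed.

Lemma local_dom_open : continuous F -> open (local_dom F i k).
Proof.
move=> cF; rewrite openE => u [x [xi Fxk] ux].
have Du : (chart i @` chart_dom i) u by exists x.
have n1 : \forall v \near u, (chart i @` chart_dom i) v.
  by apply: open_nbhs_nbhs; split => //; exact: chart_image_open.
have n2 : \forall v \near u, chart_dom k (F (param i v)).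
  have cP : param i v @[v --> u] --> param i u := param_continuous Du.
  have nb : nbhs (param i u) (F @^-1` chart_dom k).
    rewrite -ux chartK //; apply: cF; apply: open_nbhs_nbhs.
    by split => //; exact: chart_dom_open.
  exact: (cP _ nb).
rewrite /interior; apply: filterS2 n1 n2 => v [x' x'i <-]; rewrite chartK // => Fx'.
by exists x'.
Qed.

End LocalCharts.

(* The normal vector at x is given by its components xi in an arbitrary
   holomorphic chart k around F x. *)
Theorem proposition3p1 (R : realType) (n p : nat) (c : R)
    (M : smoothManifold R n) (N : kahlerManifold R (n + p)) (F : M -> N)
    (hn : (2 <= n)%N)
    (hc : c != 0)
    (hN : const_holomorphic_curvature N c)
    (hF : immersion F)
    (hreal : totally_real F)
    (hflat : flat_normal_connection F)
    (x : M) (i : chart_index M) (k : chart_index N)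
    (hx : chart_dom i x) (hFx : chart_dom k (F x))
    (xi : 'rV[R]_((n + p) + (n + p)))
    (hxi0 : xi != 0)
    (hxi : normal_space_at (metric k) (local_rep F i k) (chart i x) xi) :
  umbilical (metric k) (local_rep F i k) (chart i x) xi
  <-> J_tangent_perp (metric k) (local_rep F i k) (chart i x) xi.
Proof.
have [cF /(_ i k) [sf rf]] := hF.
have Uu : local_dom F i k (chart i x) by exists x.
have oU : open (local_dom F i k) by exact: local_dom_open.
set G := metric k; set f := local_rep F i k; set u := chart i x.
have fUD v : local_dom F i k v -> (chart k @` chart_dom k) (f v).
  exact: local_rep_image.
have symG := @Defs.metric_sym _ _ N k.
have nxi : normal_at G f u xi by apply/normal_spaceP.
have treal (Z : 'rV[R]_n) : normal_at G f u (Z *m 'J f u *m cplxJ R (n + p)).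
  apply/normal_spaceP; apply: (hreal i k u Uu).
  by exists (Z *m 'J f u) => //; exists Z.
have flat (fld : 'rV[R]_n -> 'rV[R]_((n + p) + (n + p))) :
    smooth_on (local_dom F i k) fld ->
    (forall v, local_dom F i k v -> normal_at G f v (fld v)) ->
    forall X Y, normal_curvature G f X Y fld u = 0.
  move=> sfld nfld X Y.
  have nsp v : local_dom F i k v -> normal_space_at G f v (fld v).
    by move=> Uv; apply/normal_spaceP; exact: nfld.
  exact: (hflat i k _ fld oU (fun _ Uv => Uv) sfld nsp u Uu X Y).
rewrite (umbilical_iff_beta (@chart_image_open _ _ N k) (@Defs.metric_smooth _ _ N k) symG
  (@Defs.metric_pos _ _ N k) (cplxJ_sq R (n + p)) (@Defs.metric_hermitian _ _ N k)
  (@Defs.kahler_closed _ _ N k) (hN k) hn hc oU sf fUD rf Uu flat treal nxi).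
split=> [b0|[_ perp]].
  split=> // w [t [Z _ <-] <-].
  rewrite (innerC _ _ (symG _ (fUD _ Uu))) -betaE b0 mulmx0 mxE //.
apply/colP => a; rewrite [RHS]mxE.
have := perp _ (ex_intro2 _ _ _ (ex_intro2 _ _ (delta_mx 0 a) I erefl) erefl).
by rewrite (innerC _ _ (symG _ (fUD _ Uu))) -betaE -rowE mxE.
Qed.
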